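(* Over $\Bbbk=\mathbb C(q)$, the $\mathbb C(q)$-linear monoidal categories $\mathbf{Web}^{\bullet\prime}$ and $\mathbf{Web}^\bullet$ are isomorphic by matching the generating objects and generating morphisms with the same symbols: there is an isomorphism of strict $\mathbb C(q)$-linear monoidal categories $\mathbf{Web}^{\bullet\prime}\to\mathbf{Web}^\bullet$ with $a\mapsto a$, $\mathsf m_{a,b}\mapsto\mathsf m_{a,b}$, $\mathsf s_{a,b}\mapsto\mathsf s_{a,b}$, $\mathsf c_{a,b}\mapsto\mathsf c_{a,b}$, and $\mathsf x_a\mapsto\mathsf x_a$ for all $a,b\ge1$, where $\mathsf x_a$ for $a\ge 2$ is defined in $\mathbf{Web}^{\bullet\prime}$ by $\mathsf x_a=\frac1{[a]!}\mathsf m_{1^a}\mathsf x_1^{\otimes a}\mathsf s_{1^a}$ (and the element $\frac1{[a]!}\mathsf m_{1^a}(\mathsf x_1^{-1})^{\otimes a}\mathsf s_{1^a}$ is sent to $\mathsf x_a^{-1}$).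
   Context: **Notation.** $[n]=\frac{q^n-q^{-n}}{q-q^{-1}}$, $[a]!=[1][2]\cdots[a]$, $\begin{bmatrix}n\\ a\end{bmatrix}=\frac{[n][n-1]\cdots[n-a+1]}{[a]!}$. In a strict monoidal category, $fg=f\circ g$, $\otimes$ is horizontal juxtaposition. Strands of thickness $0$ are deleted: $0$ is the unit object, and merges, splits, crossings and dots involving a $0$ are identities. Iterated merges and splits (well defined by (W1)) are $\mathsf m_{a_1,\dots,a_k}$, $\mathsf s_{a_1,\dots,a_k}$; $1^a=(1,\dots,1)$ ($a$ ones). **$\mathbf{Web}^\bullet$** (over $\mathbb C(q)$) is the strict $\mathbb C(q)$-linear monoidal category with generating objects $a\in\mathbb Z_{\ge1}$ and generating morphisms $\mathsf m_{a,b}:a\otimes b\to a+b$, $\mathsf s_{a,b}:a+b\to a\otimes b$, $\mathsf c_{a,b}:a\otimes b\to b\otimes a$, $\mathsf x_a:a\to a$, with $\mathsf c_{a,b}$ and $\mathsf x_a$ invertible, subject to, for all $a,b,c,d\ge1$: (W1) $\mathsf m_{a+b,c}(\mathsf m_{a,b}\otimes1_c)=\mathsf m_{a,b+c}(1_a\otimes\mathsf m_{b,c})$, $(\mathsf s_{a,b}\otimes1_c)\mathsf s_{a+b,c}=(1_a\otimes\mathsf s_{b,c})\mathsf s_{a,b+c}$; (W2) if $a+c=b+d$: $\mathsf s_{b,d}\mathsf m_{a,c}=\sum q^{st}(\mathsf m_{s,b-s}\otimes\mathsf m_{a-s,t})(1_s\otimes\mathsf c_{a-s,c-t}\otimes1_t)(\mathsf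 s_{s,a-s}\otimes\mathsf s_{c-t,t})$, over $0\le s\le\min(a,b)$, $0\le t\le\min(c,d)$, $t-s=d-a$; (W3) $\mathsf m_{a,b}\mathsf s_{a,b}=\begin{bmatrix}a+b\\ a\end{bmatrix}1_{a+b}$; (W4) $\mathsf c_{a,b}(\mathsf x_a\otimes1_b)=(1_b\otimes\mathsf x_a)\mathsf c_{b,a}^{-1}$, $(\mathsf x_b\otimes1_a)\mathsf c_{a,b}=\mathsf c_{b,a}^{-1}(1_a\otimes\mathsf x_b)$; (W5) $\mathsf s_{a,b}\mathsf x_{a+b}=(\mathsf x_a\otimes\mathsf x_b)\mathsf s_{a,b}$, $\mathsf x_{a+b}\mathsf m_{a,b}=\mathsf m_{a,b}(\mathsf x_a\otimes\mathsf x_b)$; (W6) $\mathsf m_{1^a}\,\mathsf x_1^{\otimes a}\,\mathsf s_{1^a}=[a]!\,\mathsf x_a$, $\mathsf m_{1^a}(\mathsf x_1^{-1})^{\otimes a}\mathsf s_{1^a}=[a]!\,\mathsf x_a^{-1}$. **$\mathbf{Web}^{\bullet\prime}$** is the strict $\mathbb C(q)$-linear monoidal category with generating objects $a\in\mathbb Z_{\ge1}$, generating morphisms $\mathsf m_{a,b},\mathsf s_{a,b},\mathsf c_{a,b}$ ($a,b\ge1$) and $\mathsf x_1:1\to1$, with $\mathsf c_{a,b}$ and $\mathsf x_1$ invertible, subject to (W1), (W2), (W3), and (W4) only for $a=b=1$. *)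

(* Defs.v *)
From HB Require Import structures.
Set Warnings "-projection-no-head-constant,-notation-overridden,-ambiguous-paths,-redundant-canonical-projection".
From mathcomp Require Import all_boot all_order all_algebra.
From mathcomp Require Import boolp reals complex zify.

Set Implicit Arguments.
Unset Strict Implicit.
Unset Printing Implicit Defensive.

Import GRing.Theory.
Local Open Scope quotient_scope.
Local Open Scope ring_scope.

(** * Strict linear monoidal categories

    Morphisms with propositionally equal but not convertible end points are
    compared as arrows, i.e. together with their source and target ([arr]). *)

Definition arr (k : fieldType) (ob : Type) (H : ob -> ob -> lmodType k)
    (x y : ob) (f : H x y) : {x : ob & {y : ob & H x y}} :=
  existT _ x (existT _ y f).

Record smcat (k : fieldType) := SMCat {
  smob :> Type;
  hom : smob -> smob -> lmodType k;
  idm : forall x, hom x x;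
  comp : forall x y z, hom y z -> hom x y -> hom x z;
  smunit : smob;
  tob : smob -> smob -> smob;
  tmor : forall x y x' y', hom x y -> hom x' y' -> hom (tob x x') (tob y y');
  compA : forall x y z w (f : hom z w) (g : hom y z) (h : hom x y),
    comp (comp f g) h = comp f (comp g h);
  comp1m : forall x y (f : hom x y), comp (idm y) f = f;
  compm1 : forall x y (f : hom x y), comp f (idm x) = f;
  comp_linearl : forall x y z (g : hom x y),
    linear (fun f : hom y z => comp f g);
  comp_linearr : forall x y z (f : hom y z),
    linear (fun g : hom x y => comp f g);
  tobA : forall x y z, tob (tob x y) z = tob x (tob y z);
  tob1x : forall x, tob smunit x = x;
  tobx1 : forall x, tob x smunit = x;
  tmorA : forall x y x' y' x'' y''
      (f : hom x y) (g : hom x' y') (h : hom x'' y''),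
    arr (tmor (tmor f g) h) = arr (tmor f (tmor g h));
  tmor1m : forall x y (f : hom x y), arr (tmor (idm smunit) f) = arr f;
  tmorm1 : forall x y (f : hom x y), arr (tmor f (idm smunit)) = arr f;
  tmor_id : forall x y, tmor (idm x) (idm y) = idm (tob x y);
  tmor_comp : forall x y z x' y' z'
      (f : hom y z) (g : hom x y) (f' : hom y' z') (g' : hom x' y'),
    tmor (comp f g) (comp f' g') = comp (tmor f f') (tmor g g');
  tmor_linearl : forall x y x' y' (g : hom x' y'),
    linear (fun f : hom x y => tmor f g);
  tmor_linearr : forall x y x' y' (f : hom x y),
    linear (fun g : hom x' y' => tmor f g)
}.

Arguments hom {k C} x y : rename.
Arguments idm {k C} x : rename.
Arguments comp {k C x y z} f g : rename.
Arguments smunit {k C} : rename.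
Arguments tob {k C} x y : rename.
Arguments tmor {k C x y x' y'} f g : rename.

(* Strict linear monoidal functors. *)
Record smfunctor (k : fieldType) (C D : smcat k) := SMFunctor {
  fob :> C -> D;
  fmor : forall x y : C, hom x y -> hom (fob x) (fob y);
  fmor_linear : forall x y, linear (@fmor x y);
  fmor_id : forall x, fmor (idm x) = idm (fob x);
  fmor_comp : forall x y z (f : hom y z) (g : hom x y),
    fmor (comp f g) = comp (fmor f) (fmor g);
  fob_unit : fob smunit = smunit;
  fob_tens : forall x y, fob (tob x y) = tob (fob x) (fob y);
  fmor_tens : forall x y x' y' (f : hom x y) (g : hom x' y'),
    arr (fmor (tmor f g)) = arr (tmor (fmor f) (fmor g))
}.

Arguments fmor {k C D} F {x y} f : rename.

Definition inverse_functors (k : fieldType) (C D : smcat k)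
    (F : smfunctor C D) (G : smfunctor D C) : Prop :=
  [/\ forall x : C, G (F x) = x,
      forall (x y : C) (f : hom x y), arr (fmor G (fmor F f)) = arr f,
      forall x : D, F (G x) = x &
      forall (x y : D) (f : hom x y), arr (fmor F (fmor G f)) = arr f].

Definition sm_isomorphism (k : fieldType) (C D : smcat k)
    (F : smfunctor C D) : Prop :=
  exists G : smfunctor D C, inverse_functors F G.

(** * Presentations

    Morphism expressions are untyped, so that strict associativity needs no
    transport; [typed f x y] says that [f] is a well formed expression
    x -> y, and [eqm P x y f g] that [f] and [g] are well formed expressions
    x -> y which are equal in the presented category. *)

Section Expressions.
Variables (k : fieldType) (I : Type) (G : Type) (gsrc gtgt : G -> seq I).

Inductive expr : Type :=
| Gen of G
| Id of seq I
| Comp of expr & expr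
| Tens of expr & expr
| Zero of seq I & seq I
| Add of expr & expr
| Scale of k & expr.

Inductive typed : expr -> seq I -> seq I -> Prop :=
| typed_gen g : typed (Gen g) (gsrc g) (gtgt g)
| typed_id x : typed (Id x) x x
| typed_comp f g x y z :
    typed f y z -> typed g x y -> typed (Comp f g) x z
| typed_tens f g x y x' y' :
    typed f x y -> typed g x' y' -> typed (Tens f g) (x ++ x') (y ++ y')
| typed_zero x y : typed (Zero x y) x y
| typed_add f g x y : typed f x y -> typed g x y -> typed (Add f g) x y
| typed_scale a f x y : typed f x y -> typed (Scale a f) x y.

End Expressions.

Arguments Gen {k I G} g.
Arguments Id {k I G} x.
Arguments Zero {k I G} x y.

Record presentation (k : fieldType) := Presentation {
  gob : Type;
  gmor : Type;
  gsrc : gmor -> seq gob;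
  gtgt : gmor -> seq gob;
  grel : seq gob -> seq gob -> expr k gob gmor -> expr k gob gmor -> Prop;
  grel_typed : forall x y f g,
    grel x y f g -> typed gsrc gtgt f x y /\ typed gsrc gtgt g x y
}.

Section Presented.
Variables (k : fieldType) (P : presentation k).

Let word := seq (gob P).
Let E := expr k (gob P) (gmor P).
Let ty := typed (k := k) (@gsrc k P) (@gtgt k P).

Inductive eqm : word -> word -> E -> E -> Prop :=
| eqm_rel x y f g : grel x y f g -> eqm x y f g
| eqm_refl x y f : ty f x y -> eqm x y f f
| eqm_sym x y f g : eqm x y f g -> eqm x y g f
| eqm_trans x y f g h : eqm x y f g -> eqm x y g h -> eqm x y f h
| eqm_comp x y z f f' g g' :
    eqm y z f f' -> eqm x y g g' -> eqm x z (Comp f g) (Comp f' g')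
| eqm_tens x y x' y' f f' g g' :
    eqm x y f f' -> eqm x' y' g g' ->
    eqm (x ++ x') (y ++ y') (Tens f g) (Tens f' g')
| eqm_add x y f f' g g' :
    eqm x y f f' -> eqm x y g g' -> eqm x y (Add f g) (Add f' g')
| eqm_scale x y a f f' :
    eqm x y f f' -> eqm x y (Scale a f) (Scale a f')
(* vector space structure on x -> y *)
| eqm_addA x y f g h : ty f x y -> ty g x y -> ty h x y ->
    eqm x y (Add f (Add g h)) (Add (Add f g) h)
| eqm_addC x y f g : ty f x y -> ty g x y -> eqm x y (Add f g) (Add g f)
| eqm_add0 x y f : ty f x y -> eqm x y (Add (Zero x y) f) f
| eqm_scale0 x y f : ty f x y -> eqm x y (Scale 0 f) (Zero x y)
| eqm_scale1 x y f : ty f x y -> eqm x y (Scale 1 f) f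
| eqm_scaleA x y a b f : ty f x y ->
    eqm x y (Scale a (Scale b f)) (Scale (a * b) f)
| eqm_scaleDr x y a f g : ty f x y -> ty g x y ->
    eqm x y (Scale a (Add f g)) (Add (Scale a f) (Scale a g))
| eqm_scaleDl x y a b f : ty f x y ->
    eqm x y (Scale (a + b) f) (Add (Scale a f) (Scale b f))
(* category *)
| eqm_compA x y z w f g h : ty f z w -> ty g y z -> ty h x y ->
    eqm x w (Comp (Comp f g) h) (Comp f (Comp g h))
| eqm_comp1m x y f : ty f x y -> eqm x y (Comp (Id y) f) f
| eqm_compm1 x y f : ty f x y -> eqm x y (Comp f (Id x)) f
| eqm_compDl x y z f g h : ty f y z -> ty g y z -> ty h x y ->
    eqm x z (Comp (Add f g) h) (Add (Comp f h) (Comp g h))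
| eqm_compDr x y z f g h : ty f y z -> ty g x y -> ty h x y ->
    eqm x z (Comp f (Add g h)) (Add (Comp f g) (Comp f h))
| eqm_compZl x y z a f g : ty f y z -> ty g x y ->
    eqm x z (Comp (Scale a f) g) (Scale a (Comp f g))
| eqm_compZr x y z a f g : ty f y z -> ty g x y ->
    eqm x z (Comp f (Scale a g)) (Scale a (Comp f g))
(* strict monoidal structure *)
| eqm_tensA x y x' y' x'' y'' f g h :
    ty f x y -> ty g x' y' -> ty h x'' y'' ->
    eqm (x ++ x' ++ x'') (y ++ y' ++ y'')
      (Tens (Tens f g) h) (Tens f (Tens g h))
| eqm_tens1m x y f : ty f x y -> eqm x y (Tens (Id [::]) f) f
| eqm_tensm1 x y f : ty f x y -> eqm x y (Tens f (Id [::])) f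
| eqm_tens_id x y : eqm (x ++ y) (x ++ y) (Tens (Id x) (Id y)) (Id (x ++ y))
| eqm_tens_comp x y z x' y' z' f g f' g' :
    ty f y z -> ty g x y -> ty f' y' z' -> ty g' x' y' ->
    eqm (x ++ x') (z ++ z')
      (Tens (Comp f g) (Comp f' g')) (Comp (Tens f f') (Tens g g'))
| eqm_tensDl x y x' y' f g h : ty f x y -> ty g x y -> ty h x' y' ->
    eqm (x ++ x') (y ++ y') (Tens (Add f g) h) (Add (Tens f h) (Tens g h))
| eqm_tensDr x y x' y' f g h : ty f x y -> ty g x' y' -> ty h x' y' ->
    eqm (x ++ x') (y ++ y') (Tens f (Add g h)) (Add (Tens f g) (Tens f h))
| eqm_tensZl x y x' y' a f g : ty f x y -> ty g x' y' ->
    eqm (x ++ x') (y ++ y') (Tens (Scale a f) g) (Scale a (Tens f g))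
| eqm_tensZr x y x' y' a f g : ty f x y -> ty g x' y' ->
    eqm (x ++ x') (y ++ y') (Tens f (Scale a g)) (Scale a (Tens f g)).

Lemma typed_cast f x y x' y' : x = x' -> y = y' -> ty f x y -> ty f x' y'.
Proof. by move=> -> ->. Qed.

Lemma eqm_typed x y f g : eqm x y f g -> ty f x y /\ ty g x y.
Proof.
elim=> {x y f g}; rewrite /ty; try by (move=> * ; split; repeat match goal with
  | H : _ /\ _ |- _ => case: H => ? ?
  end; eauto using typed).
- by move=> x y f g /grel_typed.
- move=> x y x' y' x'' y'' f g h Hf Hg Hh; split; last by eauto using typed.
  by rewrite !catA; eauto using typed.
- move=> x y f Hf; split=> //.
  exact: (typed_tens (typed_id _ _ _ [::]) Hf).
- move=> x y f Hf; split=> //.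
  rewrite -{1}(cats0 x) -{1}(cats0 y).
  exact: (typed_tens Hf (typed_id _ _ _ [::])).
Qed.

Record wfexpr (x y : word) := WfExpr {
  wf_expr : E;
  wf_exprP : typed (@gsrc k P) (@gtgt k P) wf_expr x y
}.

HB.instance Definition _ x y := gen_eqMixin (wfexpr x y).
HB.instance Definition _ x y := gen_choiceMixin (wfexpr x y).

Definition eqmb x y (f g : wfexpr x y) : bool :=
  `[< eqm x y (wf_expr f) (wf_expr g) >].

Lemma eqmb_equiv x y : equiv_class_of (@eqmb x y).
Proof.
split.
- by move=> f; apply/asboolP; apply: eqm_refl; apply: wf_exprP.
- by move=> f g; apply/asboolP/asboolP; apply: eqm_sym.
- move=> g f h /asboolP fg /asboolP gh; apply/asboolP.
  exact: eqm_trans fg gh.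
Qed.

Canonical eqmb_equiv_rel x y := EquivRelPack (@eqmb_equiv x y).

Definition phom (x y : word) := {eq_quot @eqmb x y}.

HB.instance Definition _ x y := Choice.on (phom x y).

(* The morphism x -> y given by a well formed expression. *)
Definition mor x y (f : E) (Hf : typed (@gsrc k P) (@gtgt k P) f x y) :
    phom x y :=
  \pi_(phom x y) (WfExpr Hf).

Lemma mor_eqP x y f g (Hf : ty f x y) (Hg : ty g x y) :
  mor Hf = mor Hg <-> eqm x y f g.
Proof.
by rewrite /mor; split=> [/eqmodP/asboolP //|H]; apply/eqmodP/asboolP.
Qed.

Lemma mor_ind x y (Q : phom x y -> Prop) :
  (forall f (Hf : ty f x y), Q (mor Hf)) -> forall u, Q u.
Proof.
by move=> H; elim/quotW => -[f Hf]; exact: H.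
Qed.

Definition rexpr x y (u : phom x y) : E := wf_expr (repr u).

Lemma rexprP x y (u : phom x y) : ty (rexpr u) x y.
Proof. exact: wf_exprP. Qed.

Lemma rexpr_mor x y f (Hf : ty f x y) : eqm x y (rexpr (mor Hf)) f.
Proof.
by have /eqmodP/asboolP := reprK (mor Hf).
Qed.

Definition pid x : phom x x := mor (typed_id _ _ _ x).
Definition pcomp x y z (u : phom y z) (v : phom x y) : phom x z :=
  mor (typed_comp (rexprP u) (rexprP v)).
Definition ptens x y x' y' (u : phom x y) (v : phom x' y') :
    phom (x ++ x') (y ++ y') :=
  mor (typed_tens (rexprP u) (rexprP v)).
Definition pzero x y : phom x y := mor (typed_zero _ _ _ x y).
Definition padd x y (u v : phom x y) : phom x y :=
  mor (typed_add (rexprP u) (rexprP v)).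
Definition pscale x y (a : k) (u : phom x y) : phom x y :=
  mor (typed_scale a (rexprP u)).
Definition popp x y (u : phom x y) : phom x y := pscale (-1) u.

Lemma pcompE x y z f g (Hf : ty f y z) (Hg : ty g x y) :
  pcomp (mor Hf) (mor Hg) = mor (typed_comp Hf Hg).
Proof. by apply/mor_eqP/eqm_comp; exact: rexpr_mor. Qed.

Lemma ptensE x y x' y' f g (Hf : ty f x y) (Hg : ty g x' y') :
  ptens (mor Hf) (mor Hg) = mor (typed_tens Hf Hg).
Proof. by apply/mor_eqP/eqm_tens; exact: rexpr_mor. Qed.

Lemma paddE x y f g (Hf : ty f x y) (Hg : ty g x y) :
  padd (mor Hf) (mor Hg) = mor (typed_add Hf Hg).
Proof. by apply/mor_eqP/eqm_add; exact: rexpr_mor. Qed.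

Lemma pscaleE x y a f (Hf : ty f x y) :
  pscale a (mor Hf) = mor (typed_scale a Hf).
Proof. by apply/mor_eqP/eqm_scale; exact: rexpr_mor. Qed.

Definition pE := (pcompE, ptensE, paddE, pscaleE).

Lemma paddA x y : associative (@padd x y).
Proof.
elim/mor_ind=> f Hf; elim/mor_ind=> g Hg; elim/mor_ind=> h Hh.
by rewrite !pE; apply/mor_eqP/eqm_addA.
Qed.

Lemma paddC x y : commutative (@padd x y).
Proof.
elim/mor_ind=> f Hf; elim/mor_ind=> g Hg.
by rewrite !pE; apply/mor_eqP/eqm_addC.
Qed.

Lemma padd0 x y : left_id (pzero x y) (@padd x y).
Proof. by elim/mor_ind=> f Hf; rewrite !pE; apply/mor_eqP/eqm_add0. Qed.

Lemma paddN x y : left_inverse (pzero x y) (@popp x y) (@padd x y).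
Proof.
elim/mor_ind=> f Hf; rewrite /popp !pE; apply/mor_eqP.
apply: (@eqm_trans _ _ _ (Scale (-1 + 1) f)).
  apply: (@eqm_trans _ _ _ (Add (Scale (-1) f) (Scale 1 f))).
    apply: eqm_add; first by apply: eqm_refl; apply: typed_scale.
    exact/eqm_sym/eqm_scale1.
  exact/eqm_sym/eqm_scaleDl.
by rewrite addNr; apply: eqm_scale0.
Qed.

HB.instance Definition _ x y :=
  GRing.isZmodule.Build (phom x y) (@paddA x y) (@paddC x y) (@padd0 x y)
    (@paddN x y).

Lemma pscaleA x y a b (u : phom x y) :
  pscale a (pscale b u) = pscale (a * b) u.
Proof. by elim/mor_ind: u => f Hf; rewrite !pE; apply/mor_eqP/eqm_scaleA. Qed.

Lemma pscale1 x y : left_id 1 (@pscale x y).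
Proof. by elim/mor_ind=> f Hf; rewrite !pE; apply/mor_eqP/eqm_scale1. Qed.

Lemma pscaleDr x y : right_distributive (@pscale x y) +%R.
Proof.
move=> a; elim/mor_ind=> f Hf; elim/mor_ind=> g Hg.
by rewrite /GRing.add /= !pE; apply/mor_eqP/eqm_scaleDr.
Qed.

Lemma pscaleDl x y (u : phom x y) :
  {morph (@pscale x y)^~ u : a b / a + b}.
Proof.
move=> a b; elim/mor_ind: u => f Hf.
by rewrite [RHS]/GRing.add /= !pE; apply/mor_eqP/eqm_scaleDl.
Qed.

HB.instance Definition _ x y :=
  GRing.Zmodule_isLmodule.Build k (phom x y) (@pscaleA x y) (@pscale1 x y)
    (@pscaleDr x y) (@pscaleDl x y).

Lemma phom_addE x y (u v : phom x y) : u + v = padd u v.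
Proof. by []. Qed.

Lemma phom_scaleE x y a (u : phom x y) : a *: u = pscale a u.
Proof. by []. Qed.

Lemma pcompA x y z w (u : phom z w) (v : phom y z) (t : phom x y) :
  pcomp (pcomp u v) t = pcomp u (pcomp v t).
Proof.
elim/mor_ind: u => f Hf; elim/mor_ind: v => g Hg; elim/mor_ind: t => h Hh.
by rewrite !pE; apply/mor_eqP/(eqm_compA Hf Hg Hh).
Qed.

Lemma pcomp1m x y (u : phom x y) : pcomp (pid y) u = u.
Proof. by elim/mor_ind: u => f Hf; rewrite !pE; apply/mor_eqP/eqm_comp1m. Qed.

Lemma pcompm1 x y (u : phom x y) : pcomp u (pid x) = u.
Proof. by elim/mor_ind: u => f Hf; rewrite !pE; apply/mor_eqP/eqm_compm1. Qed.

Lemma pcomp_linearl x y z (v : phom x y) :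
  linear (fun u : phom y z => pcomp u v).
Proof.
move=> a; elim/mor_ind=> f Hf; elim/mor_ind=> g Hg.
elim/mor_ind: v => h Hh; rewrite !phom_addE !phom_scaleE !pE.
apply/mor_eqP/(eqm_trans (eqm_compDl (typed_scale a Hf) Hg Hh))/eqm_add.
  exact: eqm_compZl Hf Hh.
exact/eqm_refl/(typed_comp Hg Hh).
Qed.

Lemma pcomp_linearr x y z (u : phom y z) :
  linear (fun v : phom x y => pcomp u v).
Proof.
move=> a; elim/mor_ind=> f Hf; elim/mor_ind=> g Hg.
elim/mor_ind: u => h Hh; rewrite !phom_addE !phom_scaleE !pE.
apply/mor_eqP/(eqm_trans (eqm_compDr Hh (typed_scale a Hf) Hg))/eqm_add.
  exact: eqm_compZr Hh Hf.
exact/eqm_refl/(typed_comp Hh Hg).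
Qed.

Definition plmod (x y : word) : lmodType k := phom x y.

Lemma arr_mor x y x' y' f f' (Hf : ty f x y) (Hf' : ty f' x' y') :
  x = x' -> y = y' -> eqm x' y' f f' ->
  arr (H := plmod) (mor Hf) = arr (H := plmod) (mor Hf').
Proof.
move=> ex ey; move: Hf' ; rewrite -ex -ey => Hf' eff'.
by congr (arr _); apply/mor_eqP.
Qed.

Lemma ptensA x y x' y' x'' y''
    (u : phom x y) (v : phom x' y') (t : phom x'' y'') :
  arr (H := plmod) (ptens (ptens u v) t) =
  arr (H := plmod) (ptens u (ptens v t)).
Proof.
elim/mor_ind: u => f Hf; elim/mor_ind: v => g Hg; elim/mor_ind: t => h Hh.
by rewrite !pE; apply: arr_mor; rewrite ?catA //; rewrite -!catA;
  apply: eqm_tensA.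
Qed.

Lemma ptens1m x y (u : phom x y) :
  arr (H := plmod) (ptens (pid [::]) u) = arr (H := plmod) u.
Proof.
by elim/mor_ind: u => f Hf; rewrite !pE; apply: arr_mor => //; apply: eqm_tens1m.
Qed.

Lemma ptensm1 x y (u : phom x y) :
  arr (H := plmod) (ptens u (pid [::])) = arr (H := plmod) u.
Proof.
elim/mor_ind: u => f Hf; rewrite !pE.
by apply: arr_mor; rewrite ?cats0 //; apply: eqm_tensm1.
Qed.

Lemma ptens_id x y : ptens (pid x) (pid y) = pid (x ++ y).
Proof. by rewrite !pE; apply/mor_eqP/eqm_tens_id. Qed.

Lemma ptens_comp x y z x' y' z' (u : phom y z) (v : phom x y)
    (u' : phom y' z') (v' : phom x' y') :
  ptens (pcomp u v) (pcomp u' v') = pcomp (ptens u u') (ptens v v').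
Proof.
elim/mor_ind: u => f Hf; elim/mor_ind: v => g Hg.
elim/mor_ind: u' => f' Hf'; elim/mor_ind: v' => g' Hg'.
by rewrite !pE; apply/mor_eqP/(eqm_tens_comp Hf Hg Hf' Hg').
Qed.

Lemma ptens_linearl x y x' y' (v : phom x' y') :
  linear (fun u : phom x y => ptens u v).
Proof.
move=> a; elim/mor_ind=> f Hf; elim/mor_ind=> g Hg.
elim/mor_ind: v => h Hh; rewrite !phom_addE !phom_scaleE !pE.
apply/mor_eqP/(eqm_trans (eqm_tensDl (typed_scale a Hf) Hg Hh))/eqm_add.
  exact: eqm_tensZl Hf Hh.
exact/eqm_refl/(typed_tens Hg Hh).
Qed.

Lemma ptens_linearr x y x' y' (u : phom x y) :
  linear (fun v : phom x' y' => ptens u v).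
Proof.
move=> a; elim/mor_ind=> f Hf; elim/mor_ind=> g Hg.
elim/mor_ind: u => h Hh; rewrite !phom_addE !phom_scaleE !pE.
apply/mor_eqP/(eqm_trans (eqm_tensDr Hh (typed_scale a Hf) Hg))/eqm_add.
  exact: eqm_tensZr Hh Hf.
exact/eqm_refl/(typed_tens Hh Hg).
Qed.

Lemma pcatA (x y z : word) : (x ++ y) ++ z = x ++ (y ++ z).
Proof. by rewrite catA. Qed.

Definition presented : smcat k :=
  @SMCat k word plmod pid pcomp [::] cat ptens
    pcompA pcomp1m pcompm1 pcomp_linearl pcomp_linearr
    pcatA (@cat0s _) (@cats0 _) ptensA ptens1m ptensm1 ptens_id ptens_comp
    ptens_linearl ptens_linearr.

End Presented.

(** * Quantum integers *)

Section Quantum.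
Variables (k : fieldType) (q : k).

Definition qint (n : nat) : k := (q ^+ n - q ^- n) / (q - q^-1).
Definition qfact (a : nat) : k := \prod_(1 <= i < a.+1) qint i.
Definition qbinom (n a : nat) : k := (\prod_(i < a) qint (n - i)) / qfact a.

End Quantum.

(** * Webs *)

Record thick := Thick { thick_val :> nat; thick_gt0 : (0 < thick_val)%N }.

HB.instance Definition _ := [isSub for thick_val].
HB.instance Definition _ := [Equality of thick by <:].

Definition thickS (n : nat) : thick := Thick (ltn0Sn n).

Lemma addt_gt0 (a b : thick) : (0 < a + b)%N.
Proof. by rewrite addn_gt0 thick_gt0. Qed.

Definition addt (a b : thick) : thick := Thick (addt_gt0 a b).

(* Strands of thickness 0 are deleted. *)
Definition strand (n : nat) : seq thick :=
  if n is n'.+1 then [:: thickS n'] else [::].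

Lemma strand_thick (a : thick) : strand a = [:: a].
Proof. by case: a => [[|n] // Hn]; congr [:: _]; apply: val_inj. Qed.

(* [dots a] says that there is a dot generator on strands of thickness [a].
   Invertibility of crossings and dots is imposed by adjoining formal
   inverses: [GCrossV a b] stands for the inverse of [GCross a b]. *)
Inductive webgen (dots : pred nat) : Type :=
| GMerge (a b : thick)
| GSplit (a b : thick)
| GCross (a b : thick)
| GCrossV (a b : thick)
| GDot (a : thick) of dots a
| GDotV (a : thick) of dots a.

Arguments GMerge {dots} a b.
Arguments GSplit {dots} a b.
Arguments GCross {dots} a b.
Arguments GCrossV {dots} a b.
Arguments GDot {dots} a Da.
Arguments GDotV {dots} a Da.

Definition web_src (dots : pred nat) (g : webgen dots) : seq thick :=
  match g with
  | GMerge a b => strand a ++ strand b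
  | GSplit a b => strand (a + b)
  | GCross a b => strand a ++ strand b
  | GCrossV a b => strand b ++ strand a
  | GDot a _ => strand a
  | GDotV a _ => strand a
  end.

Definition web_tgt (dots : pred nat) (g : webgen dots) : seq thick :=
  match g with
  | GMerge a b => strand (a + b)
  | GSplit a b => strand a ++ strand b
  | GCross a b => strand b ++ strand a
  | GCrossV a b => strand a ++ strand b
  | GDot a _ => strand a
  | GDotV a _ => strand a
  end.

Local Notation "f ∘ g" := (Comp f g) (at level 40, left associativity).
Local Notation "f ⊗ g" := (Tens f g) (at level 35, right associativity).
Local Notation "1_ a" := (Id (strand a)) (at level 8, a at level 2).

Section WebExpressions.
Variables (k : fieldType) (q : k) (dots : pred nat).

Let E := expr k thick (webgen dots).

Definition mrg (a b : nat) : E :=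
  match a, b with
  | a'.+1, b'.+1 => Gen (GMerge (thickS a') (thickS b'))
  | _, _ => 1_(a + b)
  end.

Definition spl (a b : nat) : E :=
  match a, b with
  | a'.+1, b'.+1 => Gen (GSplit (thickS a') (thickS b'))
  | _, _ => 1_(a + b)
  end.

Definition crs (a b : nat) : E :=
  match a, b with
  | a'.+1, b'.+1 => Gen (GCross (thickS a') (thickS b'))
  | _, _ => 1_(a + b)
  end.

Definition crsV (a b : nat) : E :=
  match a, b with
  | a'.+1, b'.+1 => Gen (GCrossV (thickS a') (thickS b'))
  | _, _ => 1_(a + b)
  end.

Definition dot (a : thick) (Da : dots a) : E := Gen (GDot a Da).
Definition dotV (a : thick) (Da : dots a) : E := Gen (GDotV a Da).

(* Iterated merges and splits, bracketed to the right. *)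
Fixpoint mrgs (s : seq nat) : E :=
  if s is a :: s' then mrg a (sumn s') ∘ (1_a ⊗ mrgs s') else Id [::].

Fixpoint spls (s : seq nat) : E :=
  if s is a :: s' then (1_a ⊗ spls s') ∘ spl a (sumn s') else Id [::].

Definition tpow (f : E) (n : nat) : E := iter n (Tens f) (Id [::]).

Definition ladder (a b c s t : nat) : E :=
  (mrg s (b - s) ⊗ mrg (a - s) t)
    ∘ (1_s ⊗ crs (a - s) (c - t) ⊗ 1_t)
    ∘ (spl s (a - s) ⊗ spl (c - t) t).

(* The condition t - s = d - a is written t + a = d + s. *)
Definition ladders (a b c d : nat) : E :=
  \big[@Add _ _ _/Zero (strand a ++ strand c) (strand b ++ strand d)]_
      (0 <= s < (minn a b).+1)
    \big[@Add _ _ _/Zero (strand a ++ strand c) (strand b ++ strand d)]_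
        (0 <= t < (minn c d).+1 | (t + a == d + s)%N)
      Scale (q ^+ (s * t)) (ladder a b c s t).

Inductive web_rel : seq thick -> seq thick -> E -> E -> Prop :=
| W1_merge (a b c : thick) :
    web_rel (strand a ++ strand b ++ strand c) (strand (a + b + c))
      (mrg (a + b) c ∘ (mrg a b ⊗ 1_c)) (mrg a (b + c) ∘ (1_a ⊗ mrg b c))
| W1_split (a b c : thick) :
    web_rel (strand (a + b + c)) (strand a ++ strand b ++ strand c)
      ((spl a b ⊗ 1_c) ∘ spl (a + b) c) ((1_a ⊗ spl b c) ∘ spl a (b + c))
| W2 (a b c d : thick) : (a + c = b + d)%N ->
    web_rel (strand a ++ strand c) (strand b ++ strand d)
      (spl b d ∘ mrg a c) (ladders a b c d)
| W3 (a b : thick) :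
    web_rel (strand (a + b)) (strand (a + b))
      (mrg a b ∘ spl a b) (Scale (qbinom q (a + b) a) 1_(a + b))
| crsVK (a b : thick) :
    web_rel (strand a ++ strand b) (strand a ++ strand b)
      (crsV a b ∘ crs a b) (Id (strand a ++ strand b))
| crsKV (a b : thick) :
    web_rel (strand b ++ strand a) (strand b ++ strand a)
      (crs a b ∘ crsV a b) (Id (strand b ++ strand a))
| dotVK (a : thick) (Da : dots a) :
    web_rel (strand a) (strand a) (dotV Da ∘ dot Da) 1_a
| dotKV (a : thick) (Da : dots a) :
    web_rel (strand a) (strand a) (dot Da ∘ dotV Da) 1_a
| W4_left (a b : thick) (Da : dots a) (Db : dots b) :
    web_rel (strand a ++ strand b) (strand b ++ strand a)
      (crs a b ∘ (dot Da ⊗ 1_b)) ((1_b ⊗ dot Da) ∘ crsV b a)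
| W4_right (a b : thick) (Da : dots a) (Db : dots b) :
    web_rel (strand a ++ strand b) (strand b ++ strand a)
      ((dot Db ⊗ 1_a) ∘ crs a b) (crsV b a ∘ (1_a ⊗ dot Db)).

Let ty := typed (k := k) (@web_src dots) (@web_tgt dots).

Lemma typed_mrg a b : ty (mrg a b) (strand a ++ strand b) (strand (a + b)).
Proof.
case: a b => [|a] [|b]; rewrite /mrg ?cats0 ?addn0;
  try exact: typed_id.
exact: (typed_gen _ _ _ (GMerge (thickS a) (thickS b))).
Qed.

Lemma typed_spl a b : ty (spl a b) (strand (a + b)) (strand a ++ strand b).
Proof.
case: a b => [|a] [|b]; rewrite /spl ?cats0 ?addn0;
  try exact: typed_id.
exact: (typed_gen _ _ _ (GSplit (thickS a) (thickS b))).
Qed.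

Lemma typed_crs a b :
  ty (crs a b) (strand a ++ strand b) (strand b ++ strand a).
Proof.
case: a b => [|a] [|b]; rewrite /crs ?cats0 ?addn0;
  try exact: typed_id.
exact: (typed_gen _ _ _ (GCross (thickS a) (thickS b))).
Qed.

Lemma typed_crsV a b :
  ty (crsV a b) (strand b ++ strand a) (strand a ++ strand b).
Proof.
case: a b => [|a] [|b]; rewrite /crsV ?cats0 ?addn0;
  try exact: typed_id.
exact: (typed_gen _ _ _ (GCrossV (thickS a) (thickS b))).
Qed.

Lemma typed_dot (a : thick) (Da : dots a) : ty (dot Da) (strand a) (strand a).
Proof. exact: (typed_gen _ _ _ (GDot a Da)). Qed.

Lemma typed_dotV (a : thick) (Da : dots a) :
  ty (dotV Da) (strand a) (strand a).
Proof. exact: (typed_gen _ _ _ (GDotV a Da)). Qed.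

Lemma typed_mrgs s :
  ty (mrgs s) (flatten [seq strand a | a <- s]) (strand (sumn s)).
Proof.
elim: s => [|a s IHs] /=; first exact: typed_id.
apply: typed_comp (typed_mrg _ _) _.
exact: typed_tens (typed_id _ _ _ _) IHs.
Qed.

Lemma typed_spls s :
  ty (spls s) (strand (sumn s)) (flatten [seq strand a | a <- s]).
Proof.
elim: s => [|a s IHs] /=; first exact: typed_id.
apply: typed_comp (typed_spl _ _).
exact: typed_tens (typed_id _ _ _ _) IHs.
Qed.

Lemma typed_tpow f n a : ty f (strand a) (strand a) ->
  ty (tpow f n) (flatten [seq strand b | b <- nseq n a])
    (flatten [seq strand b | b <- nseq n a]).
Proof.
by move=> Hf; elim: n => [|n IHn]; [exact: typed_id | exact: typed_tens].
Qed.

Lemma typed_ladder a b c d s t : (a + c = b + d)%N ->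
  (s <= a)%N -> (s <= b)%N -> (t <= c)%N -> (t <= d)%N -> (t + a = d + s)%N ->
  ty (ladder a b c s t) (strand a ++ strand c) (strand b ++ strand d).
Proof.
move=> e sa sb tc td et.
have ebs : (b - s = c - t)%N by lia.
rewrite /ladder ebs.
apply: (@typed_comp _ _ _ _ _ _ _ _
  (strand s ++ strand (a - s) ++ strand (c - t) ++ strand t)).
  apply: (@typed_comp _ _ _ _ _ _ _ _
    (strand s ++ (strand (c - t) ++ strand (a - s)) ++ strand t)).
    rewrite -catA catA.
    apply: typed_tens.
      have := typed_mrg s (c - t); rewrite -ebs subnKC //.
    have := typed_mrg (a - s) t.
    by have -> : (a - s + t = d)%N by lia.
  rewrite (catA (strand (a - s))).
  apply: typed_tens; first exact: typed_id.
  by apply: typed_tens; [exact: typed_crs | exact: typed_id].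
rewrite (catA (strand s)); apply: typed_tens.
  by have := typed_spl s (a - s); rewrite subnKC.
by have := typed_spl (c - t) t; rewrite subnK.
Qed.

Lemma typed_ladders a b c d : (a + c = b + d)%N ->
  ty (ladders a b c d) (strand a ++ strand c) (strand b ++ strand d).
Proof.
move=> e; rewrite /ladders big_nat_cond.
apply: (big_rec (fun h => ty h _ _)) => [|s f]; first exact: typed_zero.
rewrite andbT ltnS leq_min => /andP[_ /andP[sa sb]] Hf.
apply: typed_add Hf; rewrite big_nat_cond.
apply: (big_rec (fun h => ty h _ _)) => [|t g]; first exact: typed_zero.
rewrite ltnS leq_min => /andP[/andP[_ /andP[tc td]] /eqP et] Hg.
by apply: typed_add Hg; apply/typed_scale/typed_ladder.
Qed.

Lemma web_rel_typed x y f g : web_rel x y f g -> ty f x y /\ ty g x y.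
Proof.
case=> {x y f g} [a b c|a b c|a b c d e|a b|a b|a b|a Da|a Da
    |a b Da Db|a b Da Db].
- split; last (rewrite -addnA; apply: typed_comp (typed_mrg _ _) _;
      by apply: typed_tens; [apply: typed_id | apply: typed_mrg]).
  apply: typed_comp (typed_mrg _ _) _.
  by rewrite catA; apply: typed_tens (typed_id _ _ _ _); apply: typed_mrg.
- split; last (rewrite -addnA; apply: typed_comp (typed_spl _ _);
      by apply: typed_tens; [apply: typed_id | apply: typed_spl]).
  apply: typed_comp (typed_spl _ _).
  by rewrite catA; apply: typed_tens (typed_id _ _ _ _); apply: typed_spl.
- split; last exact: typed_ladders.
  apply: typed_comp (typed_mrg _ _); rewrite e; exact: typed_spl.
- split; last exact/typed_scale/typed_id.
  exact: typed_comp (typed_mrg _ _) (typed_spl _ _).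
- split; last exact: typed_id.
  exact: typed_comp (typed_crsV _ _) (typed_crs _ _).
- split; last exact: typed_id.
  exact: typed_comp (typed_crs _ _) (typed_crsV _ _).
- split; last exact: typed_id.
  exact: typed_comp (typed_dotV _) (typed_dot _).
- split; last exact: typed_id.
  exact: typed_comp (typed_dot _) (typed_dotV _).
- split.
    apply: typed_comp (typed_crs _ _) _.
    exact: typed_tens (typed_dot _) (typed_id _ _ _ _).
  apply: typed_comp (typed_crsV _ _).
  exact: typed_tens (typed_id _ _ _ _) (typed_dot _).
- split.
    apply: typed_comp (typed_crs _ _).
    exact: typed_tens (typed_dot _) (typed_id _ _ _ _).
  apply: typed_comp (typed_crsV _ _) _.
  exact: typed_tens (typed_id _ _ _ _) (typed_dot _).
Qed.

(* The expression m_{1^a} f^{⊗a} s_{1^a}, for f : 1 -> 1. *)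
Definition explode (f : E) (a : nat) : E :=
  mrgs (nseq a 1%N) ∘ tpow f a ∘ spls (nseq a 1%N).

Lemma typed_explode f a : ty f (strand 1) (strand 1) ->
  ty (explode f a) (strand a) (strand a).
Proof.
move=> Hf; have Hm := typed_mrgs (nseq a 1%N).
have Hs := typed_spls (nseq a 1%N).
rewrite sumn_nseq mul1n in Hm Hs.
exact: typed_comp (typed_comp Hm (typed_tpow a Hf)) Hs.
Qed.

End WebExpressions.

Arguments mrg {k dots} a b.
Arguments spl {k dots} a b.
Arguments dot {k dots} a Da.
Arguments dotV {k dots} a Da.
Arguments typed_mrg k dots a b : clear implicits.
Arguments typed_spl k dots a b : clear implicits.
Arguments typed_crs k dots a b : clear implicits.
Arguments typed_dot k dots a Da : clear implicits.
Arguments typed_dotV k dots a Da : clear implicits.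

Definition all_dots : pred nat := xpredT.
Definition thin_dots : pred nat := pred1 1%N.

Definition thin : thick := thickS 0.

(* The relations of Web^•. *)
Inductive dweb_rel (k : fieldType) (q : k) :
    seq thick -> seq thick ->
    expr k thick (webgen all_dots) -> expr k thick (webgen all_dots) ->
    Prop :=
| dweb_web x y f g : web_rel q x y f g -> dweb_rel q x y f g
| W5_split (a b : thick) :
    dweb_rel q (strand (a + b)) (strand a ++ strand b)
      (spl a b ∘ dot (addt a b) isT)
      ((dot a isT ⊗ dot b isT) ∘ spl a b)
| W5_merge (a b : thick) :
    dweb_rel q (strand a ++ strand b) (strand (a + b))
      (dot (addt a b) isT ∘ mrg a b)
      (mrg a b ∘ (dot a isT ⊗ dot b isT))
| W6_dot (a : thick) :
    dweb_rel q (strand a) (strand a)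
      (explode (dot thin isT) a)
      (Scale (qfact q a) (dot a isT))
| W6_dotV (a : thick) :
    dweb_rel q (strand a) (strand a)
      (explode (dotV thin isT) a)
      (Scale (qfact q a) (dotV a isT)).

Lemma dweb_rel_typed (k : fieldType) (q : k) x y f g :
  dweb_rel q x y f g ->
  typed (@web_src all_dots) (@web_tgt all_dots) f x y /\
  typed (@web_src all_dots) (@web_tgt all_dots) g x y.
Proof.
case=> {x y f g} [x y f g /web_rel_typed //|a b|a b|a|a].
- split.
    exact: typed_comp (typed_spl _ _ _ _) (typed_dot _ _ (addt a b) _).
  apply: typed_comp (typed_spl _ _ _ _).
  exact: typed_tens (typed_dot _ _ _ _) (typed_dot _ _ _ _).
- split.
    exact: typed_comp (typed_dot _ _ (addt a b) _) (typed_mrg _ _ _ _).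
  apply: typed_comp (typed_mrg _ _ _ _) _.
  exact: typed_tens (typed_dot _ _ _ _) (typed_dot _ _ _ _).
- split; last exact/typed_scale/typed_dot.
  exact/typed_explode/(typed_dot _ _ thin).
- split; last exact/typed_scale/typed_dotV.
  exact/typed_explode/(typed_dotV _ _ thin).
Qed.

Section Webs.
Variables (k : fieldType) (q : k).

Definition dweb_presentation : presentation k :=
  Presentation (@dweb_rel_typed k q).

Definition dweb'_presentation : presentation k :=
  Presentation (@web_rel_typed k q thin_dots).

(* Web^• *)
Definition dweb : smcat k := presented dweb_presentation.

(* Web^•' *)
Definition dweb' : smcat k := presented dweb'_presentation.

Definition dweb_merge (a b : thick) :
    hom (strand a ++ strand b : dweb) (strand (a + b)) :=
  mor (P := dweb_presentation) (typed_mrg _ _ a b).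
Definition dweb_split (a b : thick) :
    hom (strand (a + b) : dweb) (strand a ++ strand b) :=
  mor (P := dweb_presentation) (typed_spl _ _ a b).
Definition dweb_cross (a b : thick) :
    hom (strand a ++ strand b : dweb) (strand b ++ strand a) :=
  mor (P := dweb_presentation) (typed_crs _ _ a b).
Definition dweb_dot (a : thick) : hom (strand a : dweb) (strand a) :=
  mor (P := dweb_presentation) (typed_dot k all_dots a isT).
Definition dweb_dotV (a : thick) : hom (strand a : dweb) (strand a) :=
  mor (P := dweb_presentation) (typed_dotV k all_dots a isT).

Definition dweb'_merge (a b : thick) :
    hom (strand a ++ strand b : dweb') (strand (a + b)) :=
  mor (P := dweb'_presentation) (typed_mrg _ _ a b).
Definition dweb'_split (a b : thick) :
    hom (strand (a + b) : dweb') (strand a ++ strand b) :=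
  mor (P := dweb'_presentation) (typed_spl _ _ a b).
Definition dweb'_cross (a b : thick) :
    hom (strand a ++ strand b : dweb') (strand b ++ strand a) :=
  mor (P := dweb'_presentation) (typed_crs _ _ a b).

Definition dweb'_dot1 : hom (strand thin : dweb') (strand thin) :=
  mor (P := dweb'_presentation)
    (typed_dot k thin_dots thin isT).

(* [a]!^-1 m_{1^a} x_1^{⊗a} s_{1^a} and [a]!^-1 m_{1^a} (x_1^-1)^{⊗a} s_{1^a}
   in Web^•' *)
Definition dweb'_dot (a : thick) : hom (strand a : dweb') (strand a) :=
  (qfact q a)^-1 *:
    mor (P := dweb'_presentation)
      (typed_explode a (typed_dot k thin_dots thin isT)).
Definition dweb'_dotV (a : thick) : hom (strand a : dweb') (strand a) :=
  (qfact q a)^-1 *: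
    mor (P := dweb'_presentation)
      (typed_explode a (typed_dotV k thin_dots thin isT)).

End Webs.

(** * The base field C(q) *)

Definition Cq (R : realType) : fieldType := {fraction {poly R[i]}}.

Definition Cq_q (R : realType) : Cq R := tofrac ('X : {poly R[i]}).

(* Main.v *)
Require Import Defs.
From mathcomp Require Import all_boot all_algebra reals.
From mathcomp Require Import complex boolp zify.
Require Import Defs.

(* The point is to derive (W4)-(W6) for thick strands in Web^•'.

   First, splits slide through crossings:
     (s_{1,b} ⊗ 1) c_{a,b+1} = (1 ⊗ c_{a,b})(c_{a,1} ⊗ 1)(1 ⊗ s_{1,b}).
   Indeed c_{a,b+1} is the leading term in the expansion (W2) of
   s_{b+1,a} m_{a,b+1}; composing with s_{1,b} ⊗ 1 and using (W1) gives
   (1 ⊗ s_{b,a}) s_{1,a+b} m_{a,b+1}, which (W2) expands in a second way, and by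
   induction the two expansions agree outside the leading terms.  Reversing the
   tensor product yields the same statement for the other strand.

   Next, (W2) writes s_{1,n+1} m_{1,n+1} as
     q^{n+1} + (1 ⊗ m_{1,n})(c_{1,1} ⊗ 1)(1 ⊗ s_{1,n}),
   so that, by induction, x_1^{⊗n} commutes with s_{1^n} m_{1^n}, because
   x_1 ⊗ x_1 commutes with c_{1,1}.  As m_{1^n} s_{1^n} = [n]! is invertible, it
   follows that s_{1^n} x_n = x_1^{⊗n} s_{1^n} and x_n m_{1^n} = m_{1^n} x_1^{⊗n},
   hence (W5) and x_n x_n^{-1} = 1.  Finally (W4) is proved by splitting both
   strands until they are thin: splits are monomorphisms by (W3). *)

Set Implicit Arguments.
Unset Strict Implicit.
Unset Printing Implicit Defensive.

(** * Arrows of a strict linear monoidal category *)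

(** In a strict monoidal category the two ends of an equation between diagrams often have endpoints
    that are equal but not convertible, so fixed hom spaces would fill every calculation with
    transports. Calculations are therefore made with arrows that carry their endpoints; composition
    and addition are total on them, and endpoints return only as side conditions, settled by
    arithmetic on thicknesses.

    (W4) relates $c_{a,b}$ to $c_{b,a}^{-1}$, so a split has to pass a crossing and an inverse
    crossing in the same shape. This dictates which variants of the sliding statement are proved.
    The field enters through $[n]\neq0$ for $n\ge1$, which makes splits cancellable and $x_a$
    definable. Finally, (W6) is what makes the round trip starting from $\mathbf{Web}^\bullet$ the
    identity on thick dots. *)

Section Arrows.
Local Open Scope ring_scope.
Import GRing.Theory.
Variables (k : fieldType) (C : smcat k).

Definition arrow := {x : C & {y : C & hom x y}}.
Definition src (f : arrow) : C := let: existT x _ := f in x.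
Definition tgt (f : arrow) : C := let: existT _ (existT y _) := f in y.
Definition body (f : arrow) : hom (src f) (tgt f) :=
  let: existT _ (existT _ u) := f in u.

Definition toarr x y (f : hom x y) : arrow := arr (H := @hom k C) f.

Lemma toarr_body f : toarr (body f) = f.
Proof. by case: f => x [y f]. Qed.

(** Dependent pairs are injective in their second component as soon as equality proofs between
    objects are unique, which [Prop_irrelevance] provides for an arbitrary type of objects. *)
Lemma toarr_inj x y : injective (@toarr x y).
Proof.
have inj_existT (T : Type) (Q : T -> Type) (t : T) (u v : Q t) :
    existT Q t u = existT Q t v -> u = v.
  move=> e; have := projT2_eq e.
  by rewrite (Prop_irrelevance (projT1_eq e) erefl).
move=> f g e; apply: (@inj_existT C (fun y => hom x y) y).
exact: (@inj_existT C (fun x => {y : C & hom x y}) x).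
Qed.

(* The junk value 0 is returned when [f] is not an arrow x -> y. *)
Definition coe x y (f : arrow) : hom x y :=
  if pselect (exists u : hom x y, toarr u = f) is left H then projT1 (cid H)
  else 0.

Lemma coeE x y (f : hom x y) : coe x y (toarr f) = f.
Proof.
rewrite /coe; case: pselect => [H|[]]; last by exists f.
by case: (cid H) => /= g /toarr_inj.
Qed.

Lemma coe_mismatch x y (f : arrow) : (src f, tgt f) <> (x, y) -> coe x y f = 0.
Proof. by rewrite /coe; case: pselect => // H []; case: H => u <-. Qed.

Definition aid (x : C) : arrow := toarr (idm x).
Definition acomp (f g : arrow) : arrow :=
  toarr (comp (body f) (coe (src g) (src f) g)).
Definition atens (f g : arrow) : arrow := toarr (tmor (body f) (body g)).
Definition aadd (f g : arrow) : arrow :=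
  toarr (body f + coe (src f) (tgt f) g).
Definition ascale (a : k) (f : arrow) : arrow := toarr (a *: body f).

Lemma acompE x y z (f : hom y z) (g : hom x y) :
  acomp (toarr f) (toarr g) = toarr (comp f g).
Proof. by rewrite /acomp /= coeE. Qed.

Lemma atensE x y x' y' (f : hom x y) (g : hom x' y') :
  atens (toarr f) (toarr g) = toarr (tmor f g).
Proof. by []. Qed.

Lemma aaddE x y (f g : hom x y) : aadd (toarr f) (toarr g) = toarr (f + g).
Proof. by rewrite /aadd /= coeE. Qed.

Lemma ascaleE x y a (f : hom x y) : ascale a (toarr f) = toarr (a *: f).
Proof. by []. Qed.

Lemma arrow_homP f x y :
  src f = x -> tgt f = y -> exists u : hom x y, f = toarr u.
Proof. by move=> <- <-; exists (body f); rewrite toarr_body. Qed.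

Section Linearity.
Variables (U V : lmodType k) (h : U -> V) (h_lin : linear h).
Lemma linear_add : {morph h : u v / u + v}.
Proof. by move=> u v; have := h_lin 1 u v; rewrite !scale1r. Qed.
Lemma linear_0 : h 0 = 0.
Proof. by apply: (@addrI _ (h 0)); rewrite -linear_add !addr0. Qed.
Lemma linear_scale a u : h (a *: u) = a *: h u.
Proof. by have := h_lin a u 0; rewrite linear_0 !addr0. Qed.
End Linearity.

Section Bilinearity.
Variables x y z x' y' : C.

Lemma compDl (f f' : hom y z) (g : hom x y) :
  comp (f + f') g = comp f g + comp f' g.
Proof. exact: (linear_add (@comp_linearl k C x y z g)). Qed.

Lemma compDr (f : hom y z) (g g' : hom x y) :
  comp f (g + g') = comp f g + comp f g'.
Proof. exact: (linear_add (@comp_linearr k C x y z f)). Qed.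

Lemma comp0m (g : hom x y) : comp (0 : hom y z) g = 0.
Proof. exact: (linear_0 (@comp_linearl k C x y z g)). Qed.

Lemma compm0 (f : hom y z) : comp f (0 : hom x y) = 0.
Proof. exact: (linear_0 (@comp_linearr k C x y z f)). Qed.

Lemma compZl a (f : hom y z) (g : hom x y) : comp (a *: f) g = a *: comp f g.
Proof. exact: (linear_scale (@comp_linearl k C x y z g)). Qed.

Lemma compZr a (f : hom y z) (g : hom x y) : comp f (a *: g) = a *: comp f g.
Proof. exact: (linear_scale (@comp_linearr k C x y z f)). Qed.

Lemma tmorDl (f g : hom x y) (h : hom x' y') :
  tmor (f + g) h = tmor f h + tmor g h.
Proof. exact: (linear_add (@tmor_linearl k C x y x' y' h)). Qed.

Lemma tmorDr (h : hom x y) (f g : hom x' y') :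
  tmor h (f + g) = tmor h f + tmor h g.
Proof. exact: (linear_add (@tmor_linearr k C x y x' y' h)). Qed.

Lemma tmorZl a (f : hom x y) (h : hom x' y') : tmor (a *: f) h = a *: tmor f h.
Proof. exact: (linear_scale (@tmor_linearl k C x y x' y' h)). Qed.

Lemma tmorZr a (h : hom x y) (f : hom x' y') : tmor h (a *: f) = a *: tmor h f.
Proof. exact: (linear_scale (@tmor_linearr k C x y x' y' h)). Qed.
End Bilinearity.

(* Since mismatched arrows compose to 0, [acompA] needs no side condition. *)
Lemma acomp_mismatch f g :
  src f <> tgt g -> acomp f g = toarr (0 : hom (src g) (tgt f)).
Proof.
move=> ne; rewrite /acomp coe_mismatch ?compm0 //.
by case=> e; apply: ne; rewrite e.
Qed.

Lemma acomp0 f x y : acomp f (toarr (0 : hom x y)) = toarr (0 : hom x (tgt f)).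
Proof.
have [e|ne] := pselect (src f = y); last by rewrite acomp_mismatch.
by have [u ->] := arrow_homP e (erefl (tgt f)); rewrite acompE compm0.
Qed.

Lemma a0comp f x y : acomp (toarr (0 : hom x y)) f = toarr (0 : hom (src f) y).
Proof.
have [e|ne] := pselect (x = tgt f); last by rewrite acomp_mismatch.
by have [u ->] := arrow_homP (erefl (src f)) (esym e); rewrite acompE comp0m.
Qed.

Lemma acompA f g h : acomp (acomp f g) h = acomp f (acomp g h).
Proof.
(* The destructed pairs are folded back into [toarr], the form on which [acompE] and its analogues
   rewrite. *)
case: f g h => z' [w f] [y' [z g]] [x [y h]]; rewrite -!/(arr _) -!/(toarr _).
have [e|ne] := pselect (z' = z); last first.
  by rewrite (acomp_mismatch (g := toarr g)) // a0comp acomp_mismatch.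
have [e'|ne'] := pselect (y' = y); last first.
  by rewrite (acomp_mismatch (f := toarr g)) // acomp0 acomp_mismatch.
by subst; rewrite !acompE compA.
Qed.

Lemma acomp1f f x : x = tgt f -> acomp (aid x) f = f.
Proof.
by move=> ->; have [u ->] := arrow_homP (erefl (src f)) (erefl (tgt f));
  rewrite acompE comp1m.
Qed.

Lemma acompf1 f x : x = src f -> acomp f (aid x) = f.
Proof.
by move=> ->; have [u ->] := arrow_homP (erefl (src f)) (erefl (tgt f));
  rewrite acompE compm1.
Qed.

Lemma atensA f g h : atens (atens f g) h = atens f (atens g h).
Proof. exact: tmorA. Qed.

Lemma atens1f f x : x = smunit -> atens (aid x) f = f.
Proof. by move=> ->; rewrite -[RHS]toarr_body; apply: tmor1m. Qed.

Lemma atensf1 f x : x = smunit -> atens f (aid x) = f.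
Proof. by move=> ->; rewrite -[RHS]toarr_body; apply: tmorm1. Qed.

Lemma atens_id x y : atens (aid x) (aid y) = aid (tob x y).
Proof. by rewrite /aid atensE tmor_id. Qed.

Lemma atens_comp f g f' g' : src f = tgt g -> src f' = tgt g' ->
  atens (acomp f g) (acomp f' g') = acomp (atens f f') (atens g g').
Proof.
case: f g f' g' => y [z f] [x [y1 g]] [y' [z' f']] [x' [y1' g']] /= e e'.
by subst; rewrite -!/(arr _) -!/(toarr _) !acompE !atensE ?acompE tmor_comp.
Qed.

Lemma aaddC f g : src f = src g -> tgt f = tgt g -> aadd f g = aadd g f.
Proof.
case: f g => x [y f] [x1 [y1 g]] /= e e'; subst.
by rewrite -!/(arr _) -!/(toarr _) !aaddE addrC.
Qed.

Lemma aaddA f g h : src f = src g -> tgt f = tgt g ->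
  aadd f (aadd g h) = aadd (aadd f g) h.
Proof.
case: f g => x [y f] [x1 [y1 g]] /= e e'; subst.
rewrite -!/(arr _) -!/(toarr _) aaddE.
by rewrite [aadd (toarr g) h]/aadd aaddE /aadd /= addrA.
Qed.

Lemma aaddIr f g h : src f = src g -> tgt f = tgt g ->
  src f = src h -> tgt f = tgt h -> aadd f h = aadd g h -> f = g.
Proof.
case: f g h => x [y f] [x1 [y1 g]] [x2 [y2 h]] /= e1 e2 e3 e4; subst.
by rewrite -!/(arr _) -!/(toarr _) !aaddE => /toarr_inj /addIr ->.
Qed.

Lemma acompDl f g h : src f = src g -> tgt f = tgt g ->
  acomp (aadd f g) h = aadd (acomp f h) (acomp g h).
Proof.
case: f g h => x [y f] [x1 [y1 g]] [x2 [y2 h]] /= e1 e2; subst.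
rewrite -!/(arr _) -!/(toarr _) aaddE.
have [e|ne] := pselect (x1 = y2); last first.
  by rewrite !acomp_mismatch //= aaddE addr0.
by subst; rewrite !(aaddE, acompE) compDl.
Qed.

Lemma acompDr f g h : src g = src h -> tgt g = tgt h ->
  acomp f (aadd g h) = aadd (acomp f g) (acomp f h).
Proof.
case: f g h => x [y f] [x1 [y1 g]] [x2 [y2 h]] /= e1 e2; subst.
rewrite -!/(arr _) -!/(toarr _) aaddE.
have [e|ne] := pselect (x = y2); last first.
  by rewrite !acomp_mismatch //= aaddE addr0.
by subst; rewrite !(aaddE, acompE) compDr.
Qed.

Lemma atensDl f g h : src f = src g -> tgt f = tgt g ->
  atens (aadd f g) h = aadd (atens f h) (atens g h).
Proof.
case: f g h => x [y f] [x1 [y1 g]] [x2 [y2 h]] /= e1 e2; subst.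
by rewrite -!/(arr _) -!/(toarr _) !(aaddE, atensE) tmorDl.
Qed.

Lemma atensDr f g h : src g = src h -> tgt g = tgt h ->
  atens f (aadd g h) = aadd (atens f g) (atens f h).
Proof.
case: f g h => x [y f] [x1 [y1 g]] [x2 [y2 h]] /= e1 e2; subst.
by rewrite -!/(arr _) -!/(toarr _) !(aaddE, atensE) tmorDr.
Qed.

Lemma acompZl a f g : acomp (ascale a f) g = ascale a (acomp f g).
Proof.
by rewrite /acomp ascaleE; congr toarr; rewrite [RHS]/= -compZl.
Qed.

Lemma acompZr a f g : acomp f (ascale a g) = ascale a (acomp f g).
Proof.
case: f g => x [y f] [x1 [y1 g]]; rewrite -!/(arr _) -!/(toarr _) ascaleE.
have [e|ne] := pselect (x = y1); last first.
  by rewrite !acomp_mismatch //= ascaleE scaler0.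
by subst; rewrite !(acompE, ascaleE) compZr.
Qed.

Lemma atensZl a f g : atens (ascale a f) g = ascale a (atens f g).
Proof. by congr toarr; apply: tmorZl. Qed.

Lemma atensZr a f g : atens f (ascale a g) = ascale a (atens f g).
Proof. by congr toarr; apply: tmorZr. Qed.

Lemma ascaleA a b f : ascale a (ascale b f) = ascale (a * b) f.
Proof. by rewrite /ascale /= scalerA. Qed.

Lemma ascale1 f : ascale 1 f = f.
Proof. by rewrite /ascale scale1r toarr_body. Qed.

Lemma ascaleD a f g : src f = src g -> tgt f = tgt g ->
  ascale a (aadd f g) = aadd (ascale a f) (ascale a g).
Proof.
case: f g => x [y f] [x1 [y1 g]] /= e1 e2; subst.
by rewrite -!/(arr _) -!/(toarr _) !(aaddE, ascaleE) scalerDr.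
Qed.

(* The sum of the n+1 terms F 0, ..., F n. *)
Fixpoint asum (F : nat -> arrow) (n : nat) : arrow :=
  if n is n'.+1 then aadd (F 0%N) (asum (fun i => F i.+1) n') else F 0%N.

Lemma src_asum F n : src (asum F n) = src (F 0%N).
Proof. by case: n. Qed.

Lemma tgt_asum F n : tgt (asum F n) = tgt (F 0%N).
Proof. by case: n. Qed.

Lemma asumS F n : asum F n.+1 = aadd (F 0%N) (asum (fun i => F i.+1) n).
Proof. by []. Qed.

Lemma eq_asum F G n : (forall i, (i <= n)%N -> F i = G i) -> asum F n = asum G n.
Proof.
elim: n F G => [|n IHn] F G e /=; first exact: e.
by rewrite e // (IHn _ (fun i => G i.+1)) // => i le_in; rewrite e.
Qed.

Section Homogeneous.
Variables x y : C.
Definition homog F n := forall i, (i <= n)%N -> src (F i) = x /\ tgt (F i) = y.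

Lemma homogS F n : homog F n.+1 -> homog (fun i => F i.+1) n.
Proof. by move=> hF i le_in; apply: hF. Qed.

Lemma asum_morph (phi : arrow -> arrow) F n : homog F n ->
    (forall f g, src f = x -> src g = x -> tgt f = y -> tgt g = y ->
     phi (aadd f g) = aadd (phi f) (phi g)) ->
  phi (asum F n) = asum (fun i => phi (F i)) n.
Proof.
move=> hF phiD; elim: n F hF => [//|n IHn] F hF.
rewrite !asumS phiD ?IHn ?src_asum ?tgt_asum //;
  try (by case: (hF 0%N)); try exact: homogS; by case: (hF 1%N).
Qed.

Lemma asum_add F G n : homog F n -> homog G n ->
  asum (fun i => aadd (F i) (G i)) n = aadd (asum F n) (asum G n).
Proof.
elim: n F G => [//|n IHn] F G hF hG.
have [f1 f2] := hF 0%N isT; have [g1 g2] := hG 0%N isT.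
have [f3 f4] := hF 1%N isT; have [g3 g4] := hG 1%N isT.
rewrite asumS IHn; try exact: homogS.
have sF : src (asum (fun i => F i.+1) n) = x by rewrite src_asum.
have sG : src (asum (fun i => G i.+1) n) = x by rewrite src_asum.
have tF : tgt (asum (fun i => F i.+1) n) = y by rewrite tgt_asum.
have tG : tgt (asum (fun i => G i.+1) n) = y by rewrite tgt_asum.
rewrite -!aaddA /= ?f1 ?f2 ?g1 ?g2 //; congr aadd.
rewrite !aaddA ?g1 ?g2 //; congr aadd.
by apply: aaddC; rewrite ?g1 ?g2.
Qed.

Lemma asum_recr F n : homog F n.+1 ->
  asum F n.+1 = aadd (asum F n) (F n.+1).
Proof.
elim: n F => [//|n IHn] F hF.
have [f1 f2] := hF 0%N isT; have [f3 f4] := hF 1%N isT.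
by rewrite asumS IHn ?aaddA ?src_asum ?tgt_asum ?f1 ?f2 //; apply: homogS.
Qed.
End Homogeneous.
End Arrows.

Local Notation "f ∘ g" := (acomp f g) (at level 40, left associativity).
Local Notation "f ⊗ g" := (atens f g) (at level 35, right associativity).
Local Notation "f ⊞ g" := (aadd f g) (at level 50, left associativity).
Local Notation "a ⊙ f" := (ascale a f) (at level 38, right associativity).

Section SrcTgt.
Variables (k : fieldType) (C : smcat k).
Implicit Types f g : arrow C.

Lemma src_acomp f g : src (f ∘ g) = src g. Proof. by []. Qed.
Lemma tgt_acomp f g : tgt (f ∘ g) = tgt f. Proof. by []. Qed.
Lemma src_atens f g : src (f ⊗ g) = tob (src f) (src g). Proof. by []. Qed.
Lemma tgt_atens f g : tgt (f ⊗ g) = tob (tgt f) (tgt g). Proof. by []. Qed.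
Lemma src_aadd f g : src (f ⊞ g) = src f. Proof. by []. Qed.
Lemma tgt_aadd f g : tgt (f ⊞ g) = tgt f. Proof. by []. Qed.
Lemma src_ascale a f : src (a ⊙ f) = src f. Proof. by []. Qed.
Lemma tgt_ascale a f : tgt (a ⊙ f) = tgt f. Proof. by []. Qed.
Lemma src_aid (x : C) : src (aid x) = x. Proof. by []. Qed.
Lemma tgt_aid (x : C) : tgt (aid x) = x. Proof. by []. Qed.

Definition endpointE := (src_acomp, tgt_acomp, src_atens, tgt_atens, src_aadd,
  tgt_aadd, src_ascale, tgt_ascale, src_aid, tgt_aid, src_asum, tgt_asum).
End SrcTgt.

(** * Webs with strands of thickness at least 0 *)

(* The relation (W2) is stated for the two signs of t - s separately, so that it
   is a single sum and is preserved by reversing the tensor product. *)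
Record webs (k : fieldType) (q : k) (C : smcat k) := Webs {
  st : nat -> C;
  wmrg : nat -> nat -> arrow C;
  wspl : nat -> nat -> arrow C;
  wcrs : nat -> nat -> arrow C;
  st0 : st 0 = smunit;
  src_mrg : forall a b, src (wmrg a b) = tob (st a) (st b);
  tgt_mrg : forall a b, tgt (wmrg a b) = st (a + b);
  src_spl : forall a b, src (wspl a b) = st (a + b);
  tgt_spl : forall a b, tgt (wspl a b) = tob (st a) (st b);
  src_crs : forall a b, src (wcrs a b) = tob (st a) (st b);
  tgt_crs : forall a b, tgt (wcrs a b) = tob (st b) (st a);
  mrg0n : forall a, wmrg 0 a = aid (st a);
  mrgn0 : forall a, wmrg a 0 = aid (st a);
  spl0n : forall a, wspl 0 a = aid (st a);
  spln0 : forall a, wspl a 0 = aid (st a);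
  crs0n : forall a, wcrs 0 a = aid (st a);
  crsn0 : forall a, wcrs a 0 = aid (st a);
  splA : forall a b c,
    (wspl a b ⊗ aid (st c)) ∘ wspl (a + b) c =
    (aid (st a) ⊗ wspl b c) ∘ wspl a (b + c);
  spl_mrgR : forall a b n,
    wspl b (a + n) ∘ wmrg a (b + n) =
    asum (fun s => (q ^+ (s * (s + n)))%R ⊙
      ((wmrg s (b - s) ⊗ wmrg (a - s) (s + n))
        ∘ (aid (st s) ⊗ wcrs (a - s) (b - s) ⊗ aid (st (s + n)))
        ∘ (wspl s (a - s) ⊗ wspl (b - s) (s + n)))) (minn a b);
  spl_mrgL : forall a b n,
    wspl (b + n) a ∘ wmrg (a + n) b =
    asum (fun t => (q ^+ (t * (t + n)))%R ⊙
      ((wmrg (t + n) (b - t) ⊗ wmrg (a - t) t)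
        ∘ (aid (st (t + n)) ⊗ wcrs (a - t) (b - t) ⊗ aid (st t))
        ∘ (wspl (t + n) (a - t) ⊗ wspl (b - t) t))) (minn a b)
}.

(** * Diagrams as composites of whiskered generators *)

Section WebCalculus.
Variables (k : fieldType) (q : k) (C : smcat k) (W : webs q C).
Local Notation mrg := (wmrg W).
Local Notation spl := (wspl W).
Local Notation crs := (wcrs W).
Local Notation st := (st W).

Definition ob (s : seq nat) : C := foldr (fun a x => tob (st a) x) smunit s.

Lemma ob_cat s t : ob (s ++ t) = tob (ob s) (ob t).
Proof. by elim: s => [|a s IHs] /=; rewrite ?tob1x // IHs tobA. Qed.

Lemma ob1 a : ob [:: a] = st a.
Proof. exact: tobx1. Qed.

Definition ishom (f : arrow C) s t := src f = ob s /\ tgt f = ob t.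

Definition genE := (src_mrg, tgt_mrg, src_spl, tgt_spl, src_crs, tgt_crs).

(** The normal form of all diagrams below: a generator between identity strands. Horizontal
    composites of two generators are replaced by vertical ones, so the monoidal structure survives
    only as the interchange law [exch]. *)
Definition whisker (s : seq nat) (f : arrow C) (t : seq nat) : arrow C :=
  aid (ob s) ⊗ f ⊗ aid (ob t).

Lemma src_wh s f t : src (whisker s f t) = tob (ob s) (tob (src f) (ob t)).
Proof. by []. Qed.

Lemma tgt_wh s f t : tgt (whisker s f t) = tob (ob s) (tob (tgt f) (ob t)).
Proof. by []. Qed.
End WebCalculus.

Ltac obj_eq := repeat (match goal with
  | |- ?x = ?x => reflexivity
  | |- tob _ _ = tob _ _ => apply: f_equal2
  | |- st _ _ = st _ _ => apply: f_equal; lia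
  | |- cons _ _ = cons _ _ => apply: f_equal2
  | |- @eq nat _ _ => lia
  end).
(** Endpoints are brought to tensor words of strands bracketed to the right, then compared letter by
    letter, thicknesses by [lia]. *)
Ltac ends := rewrite ?(endpointE, src_wh, tgt_wh, genE) /=
  ?(genE, st0, tobA, tob1x, tobx1); obj_eq.

Section Whiskering.
Variables (k : fieldType) (q : k) (C : smcat k) (W : webs q C).
Local Notation mrg := (wmrg W).
Local Notation spl := (wspl W).
Local Notation crs := (wcrs W).
Local Notation st := (st W).
Local Notation wh := (whisker W).
Local Notation ob := (ob W).

Lemma mrg_hom a b c : c = a + b -> ishom W (mrg a b) [:: a; b] [:: c].
Proof. by move=> ->; split; ends. Qed.
Lemma spl_hom a b c : c = a + b -> ishom W (spl a b) [:: c] [:: a; b].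
Proof. by move=> ->; split; ends. Qed.
Lemma crs_hom a b : ishom W (crs a b) [:: a; b] [:: b; a].
Proof. by split; ends. Qed.

Lemma wh_nil f : wh [::] f [::] = f.
Proof. by rewrite /whisker /= atens1f // atensf1. Qed.

Lemma wh0l s f t : wh (0 :: s) f t = wh s f t.
Proof. by rewrite /whisker /= st0 tob1x. Qed.

Lemma wh0r s f t : wh s f (0 :: t) = wh s f t.
Proof. by rewrite /whisker /= st0 tob1x. Qed.

Lemma wh_wh s f t s' t' : wh s' (wh s f t) t' = wh (s' ++ s) f (t ++ t').
Proof. by rewrite /whisker !ob_cat -!atens_id !atensA. Qed.

Lemma wh_id s a t : wh s (aid (st a)) t = aid (ob (s ++ a :: t)).
Proof. by rewrite /whisker !atens_id ob_cat. Qed.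

Lemma wh_comp s f g t : src f = tgt g -> wh s (f ∘ g) t = wh s f t ∘ wh s g t.
Proof.
by move=> e; rewrite /whisker -!atens_comp ?endpointE ?e //; rewrite !acomp1f.
Qed.

Lemma wh_add s f g t : src f = src g -> tgt f = tgt g ->
  wh s (f ⊞ g) t = wh s f t ⊞ wh s g t.
Proof.
by move=> e e'; rewrite /whisker atensDl // atensDr // !endpointE ?e ?e'.
Qed.

Lemma wh_scale s a f t : wh s (a ⊙ f) t = a ⊙ wh s f t.
Proof. by rewrite /whisker atensZl atensZr. Qed.

(** Composites are kept bracketed to the right, so an equation between two factors has to be applied
    in front of an arbitrary tail. *)
Lemma chain (f g f' g' h : arrow C) :
  f ∘ g = f' ∘ g' -> f ∘ (g ∘ h) = f' ∘ (g' ∘ h).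
Proof. by move=> e; rewrite -!acompA e. Qed.

Lemma chain1 (f g p h : arrow C) : f ∘ g = p -> f ∘ (g ∘ h) = p ∘ h.
Proof. by move=> <-; rewrite acompA. Qed.

Lemma whl s f : aid (ob s) ⊗ f = wh s f [::].
Proof. by rewrite /whisker /= atensf1. Qed.

Lemma whr f t : f ⊗ aid (ob t) = wh [::] f t.
Proof. by rewrite /whisker /= atens1f. Qed.

Lemma whl1 a f : aid (st a) ⊗ f = wh [:: a] f [::].
Proof. by rewrite -(ob1 W) whl. Qed.

Lemma whr1 f a : f ⊗ aid (st a) = wh [::] f [:: a].
Proof. by rewrite -(ob1 W) whr. Qed.

Lemma tens_wh f g s t s' t' : ishom W f s t -> ishom W g s' t' ->
  f ⊗ g = wh [::] f t' ∘ wh s g [::].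
Proof.
move=> [sf tf] [sg tg]; rewrite -whr -whl -atens_comp ?endpointE //.
by rewrite acompf1 ?acomp1f.
Qed.

(** Interchange of two boxes at different heights, separated by the strands [z]. The words [u] and
    [v] are tied by equations because in a goal they appear as computed lists, not as
    concatenations. *)
Lemma exch x z y f g s1 t1 s2 t2 u v :
    ishom W f s1 t1 -> ishom W g s2 t2 ->
    u = x ++ t1 ++ z -> v = z ++ s2 ++ y ->
  wh u g y ∘ wh x f v = wh x f (z ++ t2 ++ y) ∘ wh (x ++ s1 ++ z) g y.
Proof.
move=> [sf tf] [sg tg] -> ->.
rewrite /whisker !ob_cat -!atens_id -?sf -?tf -?sg -?tg.
rewrite !atensA -!atens_comp ?endpointE //.
by rewrite !acomp1f ?acompf1.
Qed.

Lemma exchC x z y f g s1 t1 s2 t2 u v h :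
    ishom W f s1 t1 -> ishom W g s2 t2 ->
    u = x ++ t1 ++ z -> v = z ++ s2 ++ y ->
  wh u g y ∘ (wh x f v ∘ h) = wh x f (z ++ t2 ++ y) ∘ (wh (x ++ s1 ++ z) g y ∘ h).
Proof. by move=> hf hg e e'; apply/chain/exch; eassumption. Qed.

Lemma splA_wh x y a b c ab bc : ab = a + b -> bc = b + c ->
  wh x (spl a b) (c :: y) ∘ wh x (spl ab c) y =
  wh (rcons x a) (spl b c) y ∘ wh x (spl a bc) y.
Proof.
move=> -> ->; rewrite -cats1 -[c :: y]/([:: c] ++ y).
have {1}-> : x = x ++ [::] by rewrite cats0.
have -> : wh (x ++ [:: a]) (spl b c) y = wh x (wh [:: a] (spl b c) [::]) y.
  by rewrite wh_wh.
by rewrite -wh_wh -!wh_comp ?whr1 -?whr1 -?whl1 ?splA //; ends.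
Qed.

Lemma splA_whC x y a b c ab bc h : ab = a + b -> bc = b + c ->
  wh x (spl a b) (c :: y) ∘ (wh x (spl ab c) y ∘ h) =
  wh (rcons x a) (spl b c) y ∘ (wh x (spl a bc) y ∘ h).
Proof. by move=> e e'; apply/chain/splA_wh. Qed.

End Whiskering.

(** Multilinear expansion: sums and scalars move outwards, nested whiskers are flattened, and
    composites are bracketed to the right, ready for [chain] and [chain1]. *)
Ltac expand := repeat first
  [ rewrite acompDl; [|by ends|by ends] | rewrite acompDr; [|by ends|by ends]
  | rewrite wh_add; [|by ends|by ends] | rewrite ascaleD; [|by ends|by ends]
  | rewrite acompZl | rewrite acompZr | rewrite wh_scale | rewrite ascaleA
  | rewrite wh_comp; [|by ends] | rewrite wh_wh | rewrite wh_nil ];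
  rewrite ?acompA /=.

(** * Sliding a split through a crossing with a thin strand *)

Section ThinPitchfork.
Variables (k : fieldType) (q : k) (C : smcat k) (W : webs q C).
Local Notation mrg := (wmrg W).
Local Notation spl := (wspl W).
Local Notation crs := (wcrs W).
Local Notation st := (st W).
Local Notation wh := (whisker W).
Local Notation ob := (ob W).

(** With one thin strand, only two summands of (W2) remain: the thin strand crosses over to the
    left, or it is merged where it stands. The same dichotomy for a thin strand at the top gives
    [spl_mrg_1n]. *)
Lemma spl_mrg_n1 r t :
  spl r.+1 t.+1 ∘ mrg (t.+1 + r) 1 =
  wh [::] (mrg r 1) [:: t.+1]
    ∘ (wh [:: r] (crs t.+1 1) [::] ∘ wh [::] (spl r t.+1) [:: 1])
  ⊞ (q ^+ r.+1)%R ⊙ (wh [:: r.+1] (mrg t 1) [::] ∘ wh [::] (spl r.+1 t) [:: 1]).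
Proof.
have := spl_mrgL W t.+1 1 r; rewrite add1n => ->.
rewrite (_ : minn _ _ = 1); last by lia.
rewrite /= !mul0n !add0n !mul1n !subn0 subnn ?subSS ?subn0 !add1n.
rewrite !(mrgn0, spln0, crsn0, spl0n) GRing.expr0 ascale1.
rewrite st0 (atensf1 _ (erefl smunit)) !atens_id.
rewrite [X in _ ⊞ _ ⊙ (X ∘ _)]acompf1; last by ends.
by rewrite !whr1 !whl1 acompA.
Qed.

Lemma spl_mrg_1n u n :
  spl 1 (u.+1 + n) ∘ mrg u.+1 n.+1 =
  wh [:: 1] (mrg u.+1 n) [::]
    ∘ (wh [::] (crs u.+1 1) [:: n] ∘ wh [:: u.+1] (spl 1 n) [::])
  ⊞ (q ^+ n.+1)%R ⊙ (wh [:: 1] (mrg u n.+1) [::] ∘ wh [::] (spl 1 u) [:: n.+1]).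
Proof.
have := spl_mrgR W u.+1 1 n; rewrite add1n => ->.
rewrite (_ : minn _ _ = 1); last by lia.
rewrite /= !mul0n !add0n !mul1n !subn0 subnn ?subSS ?subn0 !add1n.
rewrite !(mrg0n, spl0n, crsn0, mrgn0) GRing.expr0 ascale1 st0.
rewrite (atens1f _ (erefl smunit)) !atens_id.
rewrite [X in _ ⊞ _ ⊙ (X ∘ _)]acompf1; last by ends.
by rewrite !whl1 !whr1 acompA.
Qed.

Lemma spl_mrg_swap t :
  spl 1 t.+1 ∘ mrg t.+1 1 =
  crs t.+1 1 ⊞ q ⊙ (wh [:: 1] (mrg t 1) [::] ∘ wh [::] (spl 1 t) [:: 1]).
Proof.
have := spl_mrg_n1 0 t; rewrite addn0 GRing.expr1 => ->.
rewrite wh0l wh_nil spl0n mrg0n !wh_id acompf1 ?acomp1f //; ends.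
Qed.

(* Both sides are obtained by expanding (1 ⊗ s_{r,t}) s_{1,r+t} m_{r+t,1}
   with (W2), before and after applying (W1). *)
Lemma spl_crs_n1 r t :
  wh [:: 1] (spl r t) [::] ∘ crs (r + t) 1 =
  wh [::] (crs r 1) [:: t]
    ∘ (wh [:: r] (crs t 1) [::] ∘ wh [::] (spl r t) [:: 1]).
Proof.
case: t => [|t].
  rewrite spln0 !crs0n !wh_id !acompf1 ?acomp1f //; ends.
  by rewrite wh0r wh_nil addn0.
case: r => [|r].
  rewrite spl0n !crs0n !wh_id acompf1 ?acomp1f; try by ends.
  by rewrite wh0l wh_nil.
have := congr1 (fun f => wh [:: 1] (spl r.+1 t.+1) [::] ∘ f)
  (spl_mrg_swap (r + t.+1)).
rewrite -acompA -{1}[spl 1 _](wh_nil W).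
rewrite -(@splA_wh _ _ _ _ [::] [::] 1 r.+1 t.+1 r.+2) ?acompA ?wh_nil; try lia.
have := spl_mrg_n1 r.+1 t; rewrite addnC => ->.
expand.
have e1 : wh [::] (spl 1 r.+1) [:: t.+1] ∘ wh [::] (mrg r.+1 1) [:: t.+1] =
    wh [::] (crs r.+1 1) [:: t.+1] ⊞ q ⊙ (wh [:: 1] (mrg r 1) [:: t.+1]
      ∘ wh [::] (spl 1 r) [:: 1; t.+1]).
  by rewrite -wh_comp ?spl_mrg_swap; [expand | ends].
have e2 : wh [:: 1] (spl r.+1 t.+1) [::] ∘ wh [:: 1] (mrg (r + t.+1) 1) [::] =
    wh [:: 1] (mrg r 1) [:: t.+1]
    ∘ (wh [:: 1; r] (crs t.+1 1) [::] ∘ wh [:: 1] (spl r t.+1) [:: 1])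
    ⊞ (q ^+ r.+1)%R ⊙ (wh [:: 1; r.+1] (mrg t 1) [::]
      ∘ wh [:: 1] (spl r.+1 t) [:: 1]).
  by rewrite -wh_comp (addnC r) ?spl_mrg_n1; [expand | ends].
rewrite (chain1 _ e1) (chain1 _ e2); expand.
rewrite -(exchC (x := [::]) (z := [::]) _ (spl_hom W (erefl (1 + r)))
  (crs_hom W t.+1 1)
  (erefl _) (erefl _)) /=.
rewrite -(exchC (x := [::]) (z := [::]) _ (spl_hom W (erefl (1 + r.+1)))
  (mrg_hom W (esym (addn1 t)))
  (erefl _) (erefl _)) /=.
rewrite (@splA_wh _ _ _ _ [::] [:: 1] 1 r t.+1 r.+1 (r + t.+1)) //.
rewrite (@splA_wh _ _ _ _ [::] [:: 1] 1 r.+1 t r.+2 (r + t.+1)) ?addnS //.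
(* Each side now has three terms. Those with coefficients $q$ and $q\cdot q^{r+1}=q^{r+2}$ coincide
   and are cancelled; the remaining terms are the two sides of the claim. *)
rewrite -GRing.exprS aaddA; try by ends.
by move=> e; symmetry; apply: (aaddIr _ _ _ _ (aaddIr _ _ _ _ e)); ends.
Qed.
End ThinPitchfork.

(** * Sliding a split through an arbitrary crossing *)

Section Pitchfork.
Variables (k : fieldType) (q : k) (C : smcat k) (W : webs q C).
Local Notation mrg := (wmrg W).
Local Notation spl := (wspl W).
Local Notation crs := (wcrs W).
Local Notation st := (st W).
Local Notation wh := (whisker W).
Local Notation ob := (ob W).

(* The ladder of (W2) with p = a - s and n = b - s. *)
Definition lad s p n t : arrow C :=
  wh [::] (mrg s n) [:: p + t] ∘ (wh [:: s; n] (mrg p t) [::]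
    ∘ (wh [:: s] (crs p n) [:: t]
    ∘ (wh [::] (spl s p) [:: n; t] ∘ wh [:: s + p] (spl n t) [::]))).

Lemma spl_mrg_lad a b n :
  spl b (a + n) ∘ mrg a (b + n) =
  asum (fun s => (q ^+ (s * (s + n)))%R ⊙ lad s (a - s) (b - s) (s + n))
    (minn a b).
Proof.
rewrite spl_mrgR; apply: eq_asum => s _; congr ascale.
rewrite (tens_wh (mrg_hom W (erefl (s + (b - s))))
  (mrg_hom W (erefl ((a - s) + (s + n))))).
rewrite (tens_wh (spl_hom W (erefl (s + (a - s))))
  (spl_hom W (erefl ((b - s) + (s + n))))).
by rewrite whr1 whl1 wh_wh /lad /= !acompA.
Qed.

(** The thin strand is peeled off the left rail of the ladder. Nothing obstructs it there, so the
    split slides down to the bottom, where associativity exchanges it with the split of $s+1+p$. *)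
Lemma spl_ladA s p n :
  wh [:: 1] (mrg s n) [:: p + s.+1] ∘ (wh [::] (spl 1 s) [:: n; p + s.+1]
    ∘ (wh [:: s.+1; n] (mrg p s.+1) [::]
    ∘ (wh [:: s.+1] (crs p n) [:: s.+1]
    ∘ (wh [::] (spl s.+1 p) [:: n; s.+1]
    ∘ wh [:: s.+1 + p] (spl n s.+1) [::])))) =
  wh [:: 1] (lad s p n s.+1) [::] ∘ wh [::] (spl 1 (s + p)) [:: n + s.+1].
Proof.
rewrite /lad; expand.
have h1 := spl_hom W (erefl (1 + s)).
rewrite -(exchC (x := [::]) (z := [:: n]) _ h1 (mrg_hom W (erefl (p + s.+1)))
  (erefl _) (erefl _)) /=.
rewrite -(exchC (x := [::]) (z := [::]) _ h1 (crs_hom W p n)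
  (erefl _) (erefl _)) /=.
rewrite (@splA_whC _ _ _ _ [::] [:: n; s.+1] 1 s p s.+1 (s + p)) //.
by rewrite (exch (x := [::]) (z := [::]) (spl_hom W (erefl (1 + (s + p))))
  (spl_hom W (erefl (n + s.+1))) (erefl _) (erefl _)).
Qed.

(** The thin strand is peeled off the rung that comes from the right. The assumed pitchfork pulls it
    back through $c_{p,n+1}$ to the bottom right split; its crossings with the strands $p$ and $r$
    are then fused into one crossing with $r+p$ by [spl_crs_n1]. *)
Lemma spl_ladB r p n :
    wh [::] (spl 1 n) [:: p] ∘ crs p n.+1 = wh [:: 1] (crs p n) [::]
      ∘ (wh [::] (crs p 1) [:: n] ∘ wh [:: p] (spl 1 n) [::]) ->
  wh [:: 1] (mrg r n) [:: p + r] ∘ (wh [::] (crs r 1) [:: n; p + r]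
    ∘ (wh [:: r] (spl 1 n) [:: p + r] ∘ (wh [:: r; n.+1] (mrg p r) [::]
    ∘ (wh [:: r] (crs p n.+1) [:: r]
    ∘ (wh [::] (spl r p) [:: n.+1; r]
    ∘ wh [:: r + p] (spl n.+1 r) [::]))))) =
  wh [:: 1] (lad r p n r) [::] ∘ (wh [::] (crs (r + p) 1) [:: n + r]
    ∘ wh [:: r + p] (spl 1 (n + r)) [::]).
Proof.
move=> e; rewrite /lad; expand.
rewrite -(exchC (x := [:: r]) (z := [::]) _ (spl_hom W (erefl (1 + n)))
  (mrg_hom W (erefl (p + r))) (erefl _) (erefl _)) /=.
have e1 := congr1 (fun f => wh [:: r] f [:: r]) e.
move: e1; expand => /chain1 ->; rewrite ?acompA.
rewrite (exchC (x := [::]) (z := [::]) _ (spl_hom W (erefl (r + p)))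
  (spl_hom W (erefl (1 + n))) (erefl _) (erefl _)) /=.
rewrite (@splA_wh _ _ _ _ [:: r + p] [::] 1 n r n.+1 (n + r)) //.
rewrite [in RHS](exchC (x := [::]) (z := [::]) _ (crs_hom W (r + p) 1)
  (spl_hom W (erefl (n + r))) (erefl _) (erefl _)) /=.
have e2 := congr1 (fun f => wh [::] f [:: n; r]) (spl_crs_n1 W r p).
move: e2; expand => /chain1 ->; rewrite ?acompA.
rewrite -(exchC (x := [::]) (z := [:: n]) _ (crs_hom W r 1)
  (mrg_hom W (erefl (p + r))) (erefl _) (erefl _)) /=.
by rewrite -(exchC (x := [::]) (z := [::]) _ (crs_hom W r 1)
  (crs_hom W p n) (erefl _) (erefl _)) /=.
Qed.

Lemma lad00 p n : lad 0 p n 0 = crs p n.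
Proof.
rewrite /lad mrg0n mrgn0 spl0n spln0 !wh_id !wh0l wh0r wh_nil.
by rewrite !acomp1f ?acompf1 //; ends.
Qed.

Definition pitchfork a b :=
  wh [::] (spl 1 b) [:: a] ∘ crs a b.+1 = wh [:: 1] (crs a b) [::]
    ∘ (wh [::] (crs a 1) [:: b] ∘ wh [:: a] (spl 1 b) [::]).

(** At the top of the ladder [spl_mrg_1n] offers two origins for the thin strand: the left rail,
    with weight $q^{n+1}$, or the rung. These are the situations of [spl_ladA] and [spl_ladB]. *)
Lemma spl_ladS i p n : pitchfork p n ->
  wh [::] (spl 1 (i + n.+1)) [:: p + i.+1] ∘ lad i.+1 p n.+1 i.+1 =
  (q ^+ n.+1)%R ⊙ (wh [:: 1] (lad i p n.+1 i.+1) [::]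
    ∘ wh [::] (spl 1 (i + p)) [:: n.+1 + i.+1])
  ⊞ wh [:: 1] (lad i.+1 p n i.+1) [::] ∘ (wh [::] (crs (i.+1 + p) 1) [:: n + i.+1]
    ∘ wh [:: i.+1 + p] (spl 1 (n + i.+1)) [::]).
Proof.
move=> hpn; rewrite -spl_ladA -(spl_ladB i.+1 hpn) {1}/lad.
have e := congr1 (fun f => wh [::] f [:: p + i.+1]) (spl_mrg_1n W i n).
move: e; rewrite addSnnS; expand => /chain1 ->; expand.
by rewrite aaddC; ends.
Qed.

(** When the rung from the right has thickness 0, the left rail is the only possible origin of the
    thin strand. *)
Lemma spl_lad_last i p :
  wh [::] (spl 1 i) [:: p + i.+1] ∘ lad i.+1 p 0 i.+1 =
  wh [:: 1] (lad i p 0 i.+1) [::] ∘ wh [::] (spl 1 (i + p)) [:: 0 + i.+1].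
Proof.
rewrite -spl_ladA {1}/lad !mrgn0 !wh_id acomp1f; last by ends.
by rewrite [RHS]acomp1f ?wh0r; last by ends.
Qed.

Lemma homog_lad (c : nat -> k) a b n m : m <= minn a b ->
  homog (tob (st a) (st (b + n))) (tob (st b) (st (a + n)))
    (fun s => c s ⊙ lad s (a - s) (b - s) (s + n)) m.
Proof. by move=> le_m i le_im; split; rewrite /lad; ends. Qed.

(* The first expansion is the sum of the [F r], the second one that of the
   [Z r] and [Y r]. *)
Lemma pitchforkP b a : pitchfork a b.
Proof.
(* The induction is strong and leaves [a] free: the ladder of index $i+1$ calls for the pitchfork
   with parameters $a-i$ and $b-i$. *)
elim/ltn_ind: b a => -[|b] IHb [|a]; rewrite /pitchfork.
- by rewrite spln0 !crsn0 !crs0n !wh_id !acompf1 //; ends.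
- by rewrite spln0 !crsn0 !wh_id !acompf1 ?acomp1f ?wh0r ?wh_nil //; ends.
- rewrite !crs0n !wh_id !acompf1 ?acomp1f ?wh0l ?wh0r //; ends.
have := congr1 (fun f => wh [::] (spl 1 b.+1) [:: a.+1] ∘ f)
  (spl_mrg_lad a.+1 b.+2 0).
rewrite !addn0 -acompA -{1}[spl b.+2 _](wh_nil W).
rewrite (@splA_wh _ _ _ _ [::] [::] 1 b.+1 a.+1 b.+2 (a.+1 + b.+1))
  ?acompA ?wh_nil; try lia.
rewrite spl_mrg_1n; expand.
have e1 := congr1 (fun f => wh [:: 1] f [::]) (spl_mrg_lad a.+1 b.+1 0).
have e2 := congr1 (fun f => wh [:: 1] f [::]) (spl_mrg_lad a b.+1 1).
rewrite !addn0 !addn1 in e1 e2; move: e1 e2; expand => /chain1 -> /chain1 ->.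
set T := wh [::] (crs a.+1 1) _ ∘ _; set U := wh [::] (spl 1 a) _.
set V := wh _ (spl 1 b.+1) [:: a.+1].
pose Z r := (q ^+ (r * r))%R ⊙ (wh [:: 1] (lad r (a.+1 - r) (b.+1 - r) r) [::] ∘ T).
pose Y r := (q ^+ b.+2 * q ^+ (r * r.+1))%R ⊙
  (wh [:: 1] (lad r (a - r) (b.+1 - r) r.+1) [::] ∘ U).
pose F r := (q ^+ (r * r))%R ⊙ (V ∘ lad r (a.+1 - r) (b.+2 - r) r).
have eZ : wh [:: 1] (asum (fun s => q ^+ (s * (s + 0)) ⊙
      lad s (a.+1 - s) (b.+1 - s) (s + 0)) (minn a.+1 b.+1))%R [::] ∘ T =
    asum Z (minn a.+1 b.+1).
  rewrite (asum_morph (phi := fun f => wh [:: 1] f [::] ∘ T)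
    (homog_lad _ 0 (leqnn _))) => [|f g e1 e2 e3 e4]; last first.
    by rewrite wh_add ?acompDl ?(endpointE, src_wh, tgt_wh, e1, e2, e3, e4).
  by apply: eq_asum => i _; rewrite /Z wh_scale acompZl !addn0.
have eY : (q ^+ b.+2)%R ⊙ (wh [:: 1] (asum (fun s => q ^+ (s * (s + 1)) ⊙
      lad s (a - s) (b.+1 - s) (s + 1)) (minn a b.+1))%R [::] ∘ U) =
    asum Y (minn a b.+1).
  rewrite (asum_morph (phi := fun f => (q ^+ b.+2)%R ⊙ (wh [:: 1] f [::] ∘ U))
    (homog_lad _ 1 (leqnn _))) => [|f g e1 e2 e3 e4]; last first.
    by rewrite wh_add ?acompDl ?ascaleD ?(endpointE, src_wh, tgt_wh, e1, e2, e3, e4).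
  by apply: eq_asum => i _; rewrite /Y wh_scale acompZl !addn1 ascaleA.
have eF : V ∘ asum (fun s => q ^+ (s * (s + 0)) ⊙
      lad s (a.+1 - s) (b.+2 - s) (s + 0))%R (minn a.+1 b.+2) =
    asum F (minn a.+1 b.+2).
  rewrite (asum_morph (phi := fun f => V ∘ f)
    (homog_lad _ 0 (leqnn _))) => [|f g e1 e2 e3 e4]; last first.
    by rewrite acompDr ?(endpointE, src_wh, tgt_wh, e1, e2, e3, e4).
  by apply: eq_asum => i _; rewrite /F acompZr !addn0.
rewrite eZ eY eF {eZ eY eF}.
have F0 : F 0 = V ∘ crs a.+1 b.+2.
  by rewrite /F GRing.expr0 ascale1 !subn0 lad00.
have Z0 : Z 0 = wh [:: 1] (crs a.+1 b.+1) [::] ∘ T.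
  by rewrite /Z GRing.expr0 ascale1 !subn0 lad00.
(* The weights agree because $(i+1)^2+(b-i+1)=(b+2)+i(i+1)$. *)
have FYZ i : i <= a -> i <= b -> F i.+1 = Y i ⊞ Z i.+1.
  move=> le_ia le_ib; rewrite /F /Y /Z !subSS (subSn le_ib).
  have lt_b : b - i < b.+1 by lia.
  have := spl_ladS i (IHb _ lt_b (a - i)).
  have -> : i + (b - i).+1 = b.+1 by lia.
  have -> : a - i + i.+1 = a.+1 by lia.
  have -> : i + (a - i) = a by lia.
  have -> : (b - i).+1 + i.+1 = b.+2 by lia.
  have -> : b - i + i.+1 = b.+1 by lia.
  have -> : i.+1 + (a - i) = a.+1 by lia.
  rewrite -/T -/U -/V => ->; rewrite ascaleD ?ascaleA -?GRing.exprD; last first.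
  - by rewrite /T /U /lad; ends.
  - by rewrite /T /U /lad; ends.
  by congr (_ ⊙ _ ⊞ _); congr (q ^+ _)%R; lia.
(* For $b<a$ the expansion [F] reaches $r=b+2$, where the rung from the right is empty: no term of
   [Z] corresponds to it, and $(b+2)^2=(b+2)+(b+1)(b+2)$. *)
have Flast : b < a -> F b.+2 = Y b.+1.
  move=> lt_ba; rewrite /F /Y !subSS !subnn.
  have := spl_lad_last b.+1 (a - b.+1).
  have -> : a - b.+1 + b.+2 = a.+1 by lia.
  have -> : b.+1 + (a - b.+1) = a by lia.
  by rewrite -/U -/V => ->; congr ascale; rewrite -GRing.exprD; congr (q ^+ _)%R; lia.
pose x := tob (st a.+1) (st b.+2); pose y := tob (st 1) (tob (st b.+1) (st a.+1)).
have hZ m : m <= minn a.+1 b.+1 -> homog x y Z m.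
  by move=> le_m i le_i; split; rewrite /x /y /Z /T /lad; ends.
have hY m : m <= minn a b.+1 -> homog x y Y m.
  by move=> le_m i le_i; split; rewrite /x /y /Y /U /lad; ends.
have [sZ tZ] := hZ 0 isT 0 isT.
have cancel S S' : src S = x -> src S' = x -> tgt S = y -> tgt S' = y ->
    Z 0 ⊞ S ⊞ S' = F 0 ⊞ (S' ⊞ S) -> F 0 = Z 0.
  have sF : src (F 0) = x by rewrite F0 /x; ends.
  have tF : tgt (F 0) = y by rewrite F0 /y; ends.
  move=> e1 e2 e3 e4 e; apply: (aaddIr (h := S' ⊞ S)).
  all: rewrite ?src_aadd ?tgt_aadd ?sF ?tF ?sZ ?tZ ?e1 ?e2 ?e3 ?e4 //.
  by rewrite -e (aaddC (f := S')) ?aaddA ?e1 ?e2 ?e3 ?e4 ?sZ ?tZ.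
rewrite -F0 -Z0.
(* The minima bounding the three sums decide how the terms pair off. For $a\le b$ every $F_{i+1}$ is
   $Y_i+Z_{i+1}$; for $b<a$ the top term of [F] matches the top term of [Y] alone. Cancelling leaves
   $F_0=Z_0$ in both cases. *)
have [le_ab|lt_ba] := leqP a b.
- have -> : minn a.+1 b.+1 = a.+1 by lia.
  have -> : minn a b.+1 = a by lia.
  have -> : minn a.+1 b.+2 = a.+1 by lia.
  have hY' : homog x y Y a by apply: hY; lia.
  have hZ' : homog x y (fun i => Z i.+1) a by apply/homogS/hZ; lia.
  rewrite !asumS (@eq_asum _ _ (fun i => F i.+1) (fun i => Y i ⊞ Z i.+1))
    => [|i le_i]; last first.
    by apply: FYZ; lia.
  rewrite (asum_add hY' hZ').
  have [sY tY] := hY' 0 isT; have [sZ' tZ'] := hZ' 0 isT.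
  by apply: cancel; rewrite ?src_asum ?tgt_asum.
- have -> : minn a.+1 b.+1 = b.+1 by lia.
  have -> : minn a b.+1 = b.+1 by lia.
  have -> : minn a.+1 b.+2 = b.+2 by lia.
  have hY1 : homog x y Y b.+1 by apply: hY; lia.
  have hY' : homog x y Y b by apply: hY; lia.
  have hZ' : homog x y (fun i => Z i.+1) b by apply/homogS/hZ; lia.
  have hF : homog x y (fun i => F i.+1) b.+1.
    move=> i; rewrite leq_eqVlt ltnS => /predU1P[->|le_i].
      by rewrite Flast //; apply: hY1.
    by rewrite FYZ; [apply: hY'|lia|].
  rewrite (asumS F) (asumS Z) (asum_recr hF) (asum_recr hY1) (Flast lt_ba).
  rewrite (@eq_asum _ _ (fun i => F i.+1) (fun i => Y i ⊞ Z i.+1))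
    => [|i le_i]; last first.
    by apply: FYZ; lia.
  rewrite (asum_add hY' hZ').
  have [sY tY] := hY' 0 isT; have [sZ' tZ'] := hZ' 0 isT.
  have [sY1 tY1] := hY1 b.+1 (leqnn _).
  set SY := asum Y b; set SZ := asum _ b.
  have sSY : src SY = x by rewrite src_asum.
  have tSY : tgt SY = y by rewrite tgt_asum.
  have sSZ : src SZ = x by rewrite src_asum.
  have tSZ : tgt SZ = y by rewrite tgt_asum.
  have -> : SY ⊞ SZ ⊞ Y b.+1 = SY ⊞ Y b.+1 ⊞ SZ.
    rewrite -!aaddA ?src_aadd ?tgt_aadd ?sSY ?tSY ?sSZ ?tSZ ?sY1 ?tY1 //.
    by rewrite (aaddC (f := SZ)) ?sSZ ?tSZ.
  by apply: cancel.
Qed.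

End Pitchfork.

(** * Reversal of the tensor product *)

Section Mirror.
Variables (k : fieldType) (q : k).

Definition revcat (C : smcat k) : smcat k := @SMCat k C (@hom k C) (@idm k C)
  (@comp k C) smunit (fun x y => tob y x) (fun x y x' y' f g => tmor g f)
  (@compA k C) (@comp1m k C) (@compm1 k C) (@comp_linearl k C) (@comp_linearr k C)
  (fun x y z => esym (tobA z y x)) (@tobx1 k C) (@tob1x k C)
  (fun x y x' y' x'' y'' f g h => esym (tmorA h g f))
  (@tmorm1 k C) (@tmor1m k C) (fun x y => tmor_id y x)
  (fun x y z x' y' z' f g f' g' => tmor_comp f' g' f g)
  (fun x y x' y' f => @tmor_linearr k C x' y' x y f)
  (fun x y x' y' f => @tmor_linearl k C x' y' x y f).

Variables (C : smcat k) (W : webs q C).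

(** Reversal swaps the two indices of each generator and exchanges [spl_mrgR] with [spl_mrgL]. The
    definition is transparent because [spl_crs_leftr] reads the reversed generators as the original
    ones by conversion. *)
Definition revwebs : webs q (revcat C).
Proof.
apply: (@Webs k q (revcat C) (st W) (fun a b => wmrg W b a)
  (fun a b => wspl W b a) (fun a b => wcrs W b a)) => [|a b|a b|a b|a b|a b|a b
  |a|a|a|a|a|a|a b c|a b n|a b n].
- exact: (st0 W).
- exact: (src_mrg W b a).
- by rewrite addnC; exact: (tgt_mrg W b a).
- by rewrite addnC; exact: (src_spl W b a).
- exact: (tgt_spl W b a).
- exact: (src_crs W b a).
- exact: (tgt_crs W b a).
- exact: (mrgn0 W a).
- exact: (mrg0n W a).
- exact: (spln0 W a).
- exact: (spl0n W a).
- exact: (crsn0 W a).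
- exact: (crs0n W a).
- by have := splA W c b a; rewrite (addnC c b) (addnC b a) => /esym.
- rewrite minnC; apply: etrans (spl_mrgL W b a n) _.
  by apply: (@eq_asum k C) => s _; rewrite -atensA.
- rewrite minnC; apply: etrans (spl_mrgR W b a n) _.
  by apply: (@eq_asum k C) => s _; rewrite -atensA.
Defined.

Lemma ob_rev s : ob revwebs s = ob W (rev s).
Proof.
elim: s => //= a s ->; rewrite rev_cons -cats1 ob_cat /=.
by rewrite tobx1.
Qed.

Lemma wh_rev s f t : whisker revwebs s f t = whisker W (rev t) f (rev s).
Proof.
rewrite /whisker !ob_rev.
exact: (@atensA k C (aid (ob W (rev t))) f (aid (ob W (rev s)))).
Qed.

Lemma spl_crs_leftr a b :
  whisker W [:: a] (wspl W b 1) [::] ∘ wcrs W b.+1 a =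
  whisker W [::] (wcrs W b a) [:: 1] ∘ (whisker W [:: b] (wcrs W 1 a) [::]
    ∘ whisker W [::] (wspl W b 1) [:: a]).
Proof. by have := pitchforkP revwebs b a; rewrite /pitchfork !wh_rev. Qed.

End Mirror.

(** * Thick dots *)

(** Kept apart from [webs], so that reversing the tensor product only has to transport the relations
    behind the sliding of splits. *)
Record dotted (k : fieldType) (q : k) (C : smcat k) (W : webs q C) := Dotted {
  wcrsV : nat -> nat -> arrow C;
  wdot : arrow C;
  wdotV : arrow C;
  src_crsV : forall a b, src (wcrsV a b) = tob (st W b) (st W a);
  tgt_crsV : forall a b, tgt (wcrsV a b) = tob (st W a) (st W b);
  src_dot : src wdot = st W 1;
  tgt_dot : tgt wdot = st W 1;
  src_dotV : src wdotV = st W 1;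
  tgt_dotV : tgt wdotV = st W 1;
  wcrsVK : forall a b, wcrsV a b ∘ wcrs W a b = aid (tob (st W a) (st W b));
  wcrsKV : forall a b, wcrs W a b ∘ wcrsV a b = aid (tob (st W b) (st W a));
  wdotVK : wdotV ∘ wdot = aid (st W 1);
  wdotKV : wdot ∘ wdotV = aid (st W 1);
  mrgA : forall a b c,
    wmrg W (a + b) c ∘ (wmrg W a b ⊗ aid (st W c)) =
    wmrg W a (b + c) ∘ (aid (st W a) ⊗ wmrg W b c);
  mrg_spl : forall a b,
    wmrg W a b ∘ wspl W a b = qbinom q (a + b) a ⊙ aid (st W (a + b));
  crs_dot11 :
    wcrs W 1 1 ∘ (wdot ⊗ aid (st W 1)) = (aid (st W 1) ⊗ wdot) ∘ wcrsV 1 1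
}.

Section Dots.
Variables (k : fieldType) (q : k) (C : smcat k) (W : webs q C) (D : dotted W).
Hypothesis qint_neq0 : forall n, 0 < n -> (qint q n != 0)%R.
Local Notation mrg := (wmrg W).
Local Notation spl := (wspl W).
Local Notation crs := (wcrs W).
Local Notation crsV := (wcrsV D).
Local Notation st := (st W).
Local Notation wh := (whisker W).
Local Notation ob := (ob W).

Lemma qfact_neq0 a : (qfact q a != 0)%R.
Proof.
rewrite /qfact big_add1 /= big_mkord.
by elim/big_ind: _ => [|x y nx ny|i _];
  [apply: GRing.oner_neq0 | apply: GRing.mulf_neq0 | apply: qint_neq0].
Qed.

Lemma qbinom_neq0 a b : (qbinom q (a + b) a != 0)%R.
Proof.
apply: GRing.mulf_neq0; last by rewrite GRing.invr_neq0 ?qfact_neq0.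
elim/big_ind: _ => [|x y nx ny|i _]; first exact: GRing.oner_neq0.
  exact: GRing.mulf_neq0.
by apply: qint_neq0; rewrite subn_gt0 ltn_addr.
Qed.

Lemma acomp_mono (g h u v : arrow C) (c : k) :
  (c != 0)%R -> g ∘ h = c ⊙ aid (src h) ->
  tgt u = src h -> tgt v = src h -> h ∘ u = h ∘ v -> u = v.
Proof.
move=> nc gh tu tv e; have := congr1 (acomp g) e.
rewrite -!acompA gh !acompZl !acomp1f // => /(congr1 (ascale c^-1)%R).
by rewrite !ascaleA GRing.mulVf // !ascale1.
Qed.

Lemma acomp_epi (g h u v : arrow C) (c : k) :
  (c != 0)%R -> g ∘ h = c ⊙ aid (tgt g) ->
  src u = tgt g -> src v = tgt g -> u ∘ g = v ∘ g -> u = v.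
Proof.
move=> nc gh tu tv e; have := congr1 (fun w => w ∘ h) e.
rewrite !acompA gh !acompZr !acompf1 // => /(congr1 (ascale c^-1)%R).
by rewrite !ascaleA GRing.mulVf // !ascale1.
Qed.

Lemma spl_mono s a b t (u v : arrow C) :
  tgt u = ob (s ++ a + b :: t) -> tgt v = ob (s ++ a + b :: t) ->
  wh s (spl a b) t ∘ u = wh s (spl a b) t ∘ v -> u = v.
Proof.
move=> tu tv; apply: (acomp_mono (g := wh s (mrg a b) t) (qbinom_neq0 a b)).
- by rewrite -wh_comp ?(mrg_spl D) ?wh_scale ?wh_id ?ob_cat; ends.
- by rewrite tu ob_cat; ends.
- by rewrite tv ob_cat; ends.
Qed.

(** [pitchforkP] peels a thin strand off on the left, while the mirrored statement, which serves the
    inverse crossings, peels it off on the right. This lemma brings the former to the shape of the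
    latter: a further cancellable split $s_{1,u}$ turns $s_{u+1,1}$ into $s_{1,u+1}$ by
    associativity, and [pitchforkP] applies at both ends. *)
Lemma spl_crs_rightn u a :
  wh [::] (spl u 1) [:: a] ∘ crs a u.+1 =
  wh [:: u] (crs a 1) [::]
    ∘ (wh [::] (crs a u) [:: 1] ∘ wh [:: a] (spl u 1) [::]).
Proof.
elim: u => [|u IHu].
  rewrite spl0n crsn0 !wh_id !acomp1f ?acompf1; try by ends.
  by rewrite wh0l wh_nil.
apply: (@spl_mono [::] 1 u [:: 1; a]); try by ends.
rewrite (@splA_whC _ _ _ _ [::] [:: a] 1 u 1 u.+1 u.+1) ?addn1 //=.
rewrite pitchforkP.
move: (congr1 (fun f => wh [:: 1] f [::]) IHu); expand => /chain1 ->; expand.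
rewrite (exchC (x := [::]) (z := [::]) _ (crs_hom W a 1)
  (spl_hom W (esym (addn1 u))) (erefl _) (erefl _)) /=.
rewrite -(@splA_wh _ _ _ _ [:: a] [::] 1 u 1 u.+1 u.+1) ?addn1 //.
rewrite -(exchC (x := [::]) (z := [::]) _ (spl_hom W (erefl (1 + u)))
  (crs_hom W a 1) (erefl _) (erefl _)) /=.
move: (congr1 (fun f => wh [::] f [:: 1]) (pitchforkP W u a)); expand => /chain1 ->.
by expand.
Qed.

Lemma wcrsV0n a : crsV 0 a = aid (st a).
Proof.
have := wcrsVK D 0 a; rewrite crs0n st0 tob1x acompf1 //.
by rewrite src_crsV st0 tobx1.
Qed.

Lemma wcrsVn0 a : crsV a 0 = aid (st a).
Proof.
have := wcrsVK D a 0; rewrite crsn0 st0 tobx1 acompf1 //.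
by rewrite src_crsV st0 tob1x.
Qed.

Lemma crsV_hom a b : ishom W (crsV a b) [:: b; a] [:: a; b].
Proof. by split; rewrite ?src_crsV ?tgt_crsV; ends. Qed.

Fixpoint wspls n : arrow C :=
  if n is n'.+1 then (aid (st 1) ⊗ wspls n') ∘ spl 1 n' else aid smunit.
Fixpoint wmrgs n : arrow C :=
  if n is n'.+1 then mrg 1 n' ∘ (aid (st 1) ⊗ wmrgs n') else aid smunit.
Fixpoint wtpow f n : arrow C := if n is n'.+1 then f ⊗ wtpow f n' else aid smunit.
(** The thin arrow [f] is arbitrary because the construction serves both $x_1$ and $x_1^{-1}$. *)
Definition thick_dot f n : arrow C :=
  (qfact q n)^-1%R ⊙ (wmrgs n ∘ wtpow f n ∘ wspls n).

Definition ones n := ob (nseq n 1).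

Lemma src_spls n : src (wspls n) = st n.
Proof. by case: n => [|n]; rewrite /= ?st0 // src_spl. Qed.
Lemma tgt_spls n : tgt (wspls n) = ones n.
Proof. by elim: n => //= n IHn; rewrite IHn. Qed.
Lemma src_mrgs n : src (wmrgs n) = ones n.
Proof. by elim: n => //= n IHn; rewrite IHn. Qed.
Lemma tgt_mrgs n : tgt (wmrgs n) = st n.
Proof. by case: n => [|n]; rewrite /= ?st0 // tgt_mrg. Qed.

Lemma qfact1 : qfact q 1 = 1%R.
Proof.
rewrite /qfact big_nat1 /qint GRing.expr1 GRing.divff //.
(* The hypothesis at $n=1$ also says that $q\neq q^{-1}$; otherwise $[1]$ would be the default value
   $0/0=0$. *)
have := qint_neq0 (isT : 0 < 1); rewrite /qint GRing.expr1.
by apply: contra => /eqP ->; rewrite GRing.mul0r.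
Qed.

Lemma qbinom1 n : qbinom q n.+1 1 = qint q n.+1.
Proof. by rewrite /qbinom qfact1 big_ord1 subn0 GRing.divr1. Qed.

Lemma mrgs_spls n : wmrgs n ∘ wspls n = qfact q n ⊙ aid (st n).
Proof.
elim: n => [|n IHn] /=.
  by rewrite /qfact big_nil ascale1 st0 acomp1f.
rewrite acompA -[(_ ⊗ _) ∘ (_ ∘ _)]acompA -atens_comp ?src_mrgs ?tgt_spls //.
rewrite IHn acomp1f // atensZr acompZl acompZr atens_id acomp1f; last by ends.
rewrite (mrg_spl D) add1n qbinom1 ascaleA; congr ascale.
rewrite [RHS]/qfact big_nat_recr //=.
Qed.

(** * Thick dots made from one thin arrow *)

Section OneDot.
Variable f : arrow C.
Hypotheses (src_f : src f = st 1) (tgt_f : tgt f = st 1).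
Hypothesis crs_ff : crs 1 1 ∘ (f ⊗ f) = (f ⊗ f) ∘ crs 1 1.
Local Notation x := (thick_dot f).
Local Notation X := (wtpow f).

Lemma src_tpow n : src (X n) = ones n.
Proof. by elim: n => //= n IHn; rewrite IHn src_f. Qed.
Lemma tgt_tpow n : tgt (X n) = ones n.
Proof. by elim: n => //= n IHn; rewrite IHn tgt_f. Qed.
Lemma src_thick_dot n : src (x n) = st n.
Proof. by rewrite /= src_spls. Qed.
Lemma tgt_thick_dot n : tgt (x n) = st n.
Proof. by rewrite /= tgt_mrgs. Qed.

Definition dotE := (src_f, tgt_f, src_tpow, tgt_tpow, src_thick_dot,
  tgt_thick_dot, src_spls, tgt_spls, src_mrgs, tgt_mrgs).

Definition thick_dot_comm n :=
  wspls n ∘ x n = X n ∘ wspls n /\ x n ∘ wmrgs n = wmrgs n ∘ X n.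

(** Up to the factor $[n]!$, the composite $s_{1^n}m_{1^n}$ is an idempotent with image the thick
    strand, and $x_n$ is the compression of $f^{\otimes n}$ to it. An arrow commuting with the
    idempotent is intertwined with its compression. *)
Lemma thick_dot_comm_suff n :
  X n ∘ (wspls n ∘ wmrgs n) = wspls n ∘ wmrgs n ∘ X n -> thick_dot_comm n.
Proof.
move=> e; have nz := qfact_neq0 n; split; rewrite /thick_dot.
  rewrite acompZr -!acompA -e !acompA mrgs_spls !acompZr acompf1 ?dotE //.
  by rewrite ascaleA GRing.mulVf // ascale1.
rewrite acompZl !acompA e -!acompA mrgs_spls !acompZl acomp1f ?dotE //.
by rewrite ascaleA GRing.mulVf // ascale1.
Qed.

Lemma spls_mono n u v : tgt u = st n -> tgt v = st n ->
  wspls n ∘ u = wspls n ∘ v -> u = v.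
Proof.
move=> tu tv; apply: (acomp_mono (g := wmrgs n) (qfact_neq0 n)); rewrite ?dotE //.
exact: mrgs_spls.
Qed.

Lemma tens_mono u v a b g h : tgt g = tob (st a) (st b) ->
  tgt h = tob (st a) (st b) -> u = wspls a -> v = wspls b ->
  (u ⊗ v) ∘ g = (u ⊗ v) ∘ h -> g = h.
Proof.
move=> tg th -> ->.
apply: (acomp_mono (g := wmrgs a ⊗ wmrgs b) (c := qfact q b * qfact q a)%R).
- by rewrite GRing.mulf_neq0 ?qfact_neq0.
- rewrite -atens_comp ?dotE // !mrgs_spls atensZl atensZr atens_id.
  by rewrite ascaleA !endpointE !dotE GRing.mulrC.
- by rewrite !endpointE !dotE.
- by rewrite !endpointE !dotE.
Qed.

Lemma tens_epi u v a b g h : src g = tob (st a) (st b) ->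
  src h = tob (st a) (st b) -> u = wmrgs a -> v = wmrgs b ->
  g ∘ (u ⊗ v) = h ∘ (u ⊗ v) -> g = h.
Proof.
move=> sg sh -> ->.
apply: (acomp_epi (h := wspls a ⊗ wspls b) (c := qfact q b * qfact q a)%R).
- by rewrite GRing.mulf_neq0 ?qfact_neq0.
- rewrite -atens_comp ?dotE // !mrgs_spls atensZl atensZr atens_id.
  by rewrite ascaleA !endpointE !dotE GRing.mulrC.
- by rewrite !endpointE !dotE.
- by rewrite !endpointE !dotE.
Qed.

Lemma spls1 : wspls 1 = aid (st 1).
Proof. by rewrite /= spln0 acompf1 ?atensf1 //= ?tobx1. Qed.

Lemma mrgs1 : wmrgs 1 = aid (st 1).
Proof. by rewrite /= mrgn0 acomp1f ?atensf1 //= ?tobx1. Qed.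

Lemma splsD a b : wspls (a + b) = (wspls a ⊗ wspls b) ∘ spl a b.
Proof.
elim: a => [|a IHa].
  by rewrite spl0n /= atens1f // acompf1 // dotE.
rewrite addSn /= IHa -{1}(@acompf1 _ _ (aid (st 1)) (st 1)) //.
rewrite atens_comp ?endpointE ?dotE ?tgt_spl // acompA -splA -!acompA -atensA.
congr (_ ∘ _); rewrite -atens_comp ?endpointE ?dotE ?tgt_spl //.
by rewrite acompf1 ?dotE.
Qed.

Lemma mrgsD a b : wmrgs (a + b) = mrg a b ∘ (wmrgs a ⊗ wmrgs b).
Proof.
elim: a => [|a IHa].
  by rewrite mrg0n /= atens1f // acomp1f // dotE.
rewrite addSn /= IHa -{1}(@acompf1 _ _ (aid (st 1)) (st 1)) //.
rewrite atens_comp ?endpointE ?dotE ?src_mrg // -acompA -(mrgA D) !acompA -atensA.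
congr (_ ∘ _); rewrite -atens_comp ?endpointE ?dotE ?src_mrg //.
by rewrite acomp1f ?dotE.
Qed.

Lemma tpowD a b : X (a + b) = X a ⊗ X b.
Proof. by elim: a => [|a IHa] /=; rewrite ?atens1f // IHa atensA. Qed.

(** After the monomorphism $s_{1^a}\otimes s_{1^b}$ both sides equal $f^{\otimes(a+b)}s_{1^{a+b}}$.
    The commutation properties are hypotheses because the lemma is used within the induction that
    establishes them. *)
Lemma thick_dot_spl_comm a b : thick_dot_comm a -> thick_dot_comm b ->
  thick_dot_comm (a + b) -> spl a b ∘ x (a + b) = (x a ⊗ x b) ∘ spl a b.
Proof.
move=> [ha _] [hb _] [hab _].
apply: (tens_mono (a := a) (b := b) _ _ erefl erefl).
- by rewrite !endpointE tgt_spl.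
- by rewrite !endpointE !dotE.
rewrite -acompA -splsD hab splsD tpowD -[RHS]acompA -acompA.
by rewrite -!atens_comp ?dotE // ha hb.
Qed.

Lemma thick_dot_mrg_comm a b : thick_dot_comm a -> thick_dot_comm b ->
  thick_dot_comm (a + b) -> x (a + b) ∘ mrg a b = mrg a b ∘ (x a ⊗ x b).
Proof.
move=> [_ ha] [_ hb] [_ hab].
apply: (tens_epi (a := a) (b := b) _ _ erefl erefl).
- by rewrite !endpointE src_mrg.
- by rewrite !endpointE !dotE.
rewrite !acompA -mrgsD hab mrgsD tpowD acompA.
by rewrite -!atens_comp ?dotE // ha hb.
Qed.

Lemma thick_dot1 : x 1 = f.
Proof.
rewrite /thick_dot spls1 mrgs1 /= atensf1 // acomp1f ?acompf1 //.
by rewrite qfact1 GRing.invr1 ascale1.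
Qed.

Lemma tens_slide u v g : src u = tgt g -> src g = tgt v -> u ∘ g = g ∘ v ->
  (f ⊗ u) ∘ (aid (st 1) ⊗ g) = (aid (st 1) ⊗ g) ∘ (f ⊗ v).
Proof.
move=> sug sgv e; rewrite -!atens_comp ?endpointE ?dotE // e.
by rewrite acompf1 ?acomp1f ?dotE.
Qed.

Lemma thick_dot_comm1 : thick_dot_comm 1.
Proof.
apply: thick_dot_comm_suff; rewrite spls1 mrgs1 acomp1f // acompf1.
  by rewrite acomp1f ?dotE // /ones /= tobx1.
by rewrite dotE /ones /= tobx1.
Qed.

(** The induction carries two consecutive values: the expansion of $s_{1,n+1}m_{1,n+1}$ contains
    $m_{1,n}$ and $s_{1,n}$, and moving $x_{n+1}$ past these takes the property for both $n$ and
    $n+1$. *)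
Lemma thick_dot_commP n : thick_dot_comm n.
Proof.
suff: thick_dot_comm n /\ thick_dot_comm n.+1 by case.
elim: n => [|n [IHn IHn1]].
  split; last exact: thick_dot_comm1.
  by apply: thick_dot_comm_suff; rewrite /= !acomp1f.
split=> //; apply: thick_dot_comm_suff.
have Dh : spl 1 n.+1 ∘ mrg 1 n.+1 =
    (aid (st 1) ⊗ mrg 1 n) ∘ ((crs 1 1 ⊗ aid (st n)) ∘ (aid (st 1) ⊗ spl 1 n))
    ⊞ (q ^+ n.+1)%R ⊙ aid (tob (st 1) (st n.+1)).
  rewrite !whl1 whr1; have := spl_mrg_1n W 0 n; rewrite add1n => ->.
  congr (_ ⊞ _ ⊙ _); rewrite mrg0n spln0 !wh_id acomp1f //.
  by rewrite /= !tobx1.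
(* [y] is what $f^{\otimes(n+2)}$ becomes once it has passed the inner splits or merges on $n+1$
   strands; it remains to commute [y] with $s_{1,n+1}m_{1,n+1}$. *)
pose y := f ⊗ x n.+1.
have y1 : X n.+2 ∘ (aid (st 1) ⊗ wspls n.+1) = (aid (st 1) ⊗ wspls n.+1) ∘ y.
  by apply: tens_slide (esym (proj1 IHn1)); rewrite ?dotE.
have y2 : (aid (st 1) ⊗ wmrgs n.+1) ∘ X n.+2 = y ∘ (aid (st 1) ⊗ wmrgs n.+1).
  by symmetry; apply: tens_slide (proj2 IHn1); rewrite ?dotE.
have hm : x n.+1 ∘ mrg 1 n = mrg 1 n ∘ (f ⊗ x n).
  have h1 := thick_dot_comm1; rewrite -{2}thick_dot1.
  exact: (@thick_dot_mrg_comm 1 n).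
have hs : spl 1 n ∘ x n.+1 = (f ⊗ x n) ∘ spl 1 n.
  have h1 := thick_dot_comm1; rewrite -{2}thick_dot1.
  exact: (@thick_dot_spl_comm 1 n).
have yD : y ∘ (spl 1 n.+1 ∘ mrg 1 n.+1) = (spl 1 n.+1 ∘ mrg 1 n.+1) ∘ y.
  rewrite Dh; rewrite acompDr; [|by rewrite /y; ends|by rewrite /y; ends].
  rewrite acompDl; [|by rewrite /y; ends|by rewrite /y; ends].
  have sy : src y = tob (st 1) (st n.+1) by rewrite /y endpointE !dotE.
  have ty : tgt y = tob (st 1) (st n.+1) by rewrite /y endpointE !dotE.
  rewrite acompZl acompZr [y ∘ aid _]acompf1 // [aid _ ∘ y]acomp1f //.
  congr (_ ⊞ _).
  (* [z] is [y] one level further in, where the two strands meeting at $c_{1,1}$ both carry [f] and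
     [crs_ff] applies. *)
  pose z := f ⊗ f ⊗ x n.
  have z1 : y ∘ (aid (st 1) ⊗ mrg 1 n) = (aid (st 1) ⊗ mrg 1 n) ∘ z.
    by apply: tens_slide hm; [rewrite src_thick_dot tgt_mrg
      | rewrite src_mrg tgt_atens tgt_f tgt_thick_dot].
  have z2 : (aid (st 1) ⊗ spl 1 n) ∘ y = z ∘ (aid (st 1) ⊗ spl 1 n).
    symmetry; apply: tens_slide (esym hs);
      [rewrite tgt_spl src_atens src_f | rewrite src_spl];
      by rewrite ?src_thick_dot ?tgt_thick_dot.
  have z3 : z ∘ (crs 1 1 ⊗ aid (st n)) = (crs 1 1 ⊗ aid (st n)) ∘ z.
    rewrite /z -!atensA -!atens_comp ?endpointE ?dotE ?src_crs ?tgt_crs //.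
    by rewrite crs_ff acompf1 ?acomp1f ?dotE.
  by rewrite !acompA z2 (chain _ z1) (chain _ z3).
rewrite [wspls n.+2]/= [wmrgs n.+2]/= -/(wspls n.+1) -/(wmrgs n.+1).
rewrite !acompA y2 (chain _ y1); congr (_ ∘ _).
by rewrite -[spl 1 n.+1 ∘ (mrg _ _ ∘ (aid _ ⊗ _))]acompA (chain _ yD) !acompA.
Qed.

Lemma thick_dot_spl a b : spl a b ∘ x (a + b) = (x a ⊗ x b) ∘ spl a b.
Proof. by apply: thick_dot_spl_comm; apply: thick_dot_commP. Qed.

Lemma thick_dot_mrg a b : x (a + b) ∘ mrg a b = mrg a b ∘ (x a ⊗ x b).
Proof. by apply: thick_dot_mrg_comm; apply: thick_dot_commP. Qed.

Lemma thick_dot0 : x 0 = aid (st 0).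
Proof.
by rewrite /thick_dot /= /qfact big_nil GRing.invr1 ascale1 !acomp1f // st0.
Qed.

Lemma thick_dot_hom n : ishom W (x n) [:: n] [:: n].
Proof. by split; rewrite ?src_thick_dot ?tgt_thick_dot /= tobx1. Qed.

Lemma thick_dot_spl_wh s t a b :
  wh s (spl a b) t ∘ wh s (x (a + b)) t =
  wh s (x a) (b :: t) ∘ (wh (rcons s a) (x b) t ∘ wh s (spl a b) t).
Proof.
have e := thick_dot_spl a b.
rewrite (tens_wh (thick_dot_hom a) (thick_dot_hom b)) in e.
rewrite -wh_comp ?src_spl ?tgt_thick_dot // e !acompA.
rewrite !wh_comp ?wh_wh ?cats0 ?cats1 //.
all: rewrite ?(endpointE, src_wh, tgt_wh, dotE, tgt_spl) /= ?tob1x ?tobx1 //.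
Qed.
End OneDot.

Lemma tpow_comp f g n : src f = tgt g -> wtpow f n ∘ wtpow g n = wtpow (f ∘ g) n.
Proof.
move=> e; elim: n => [|n IHn] /=; first by rewrite acomp1f.
have et : src (wtpow f n) = tgt (wtpow g n).
  by elim: n {IHn} => //= n ->; rewrite e.
by rewrite -atens_comp // IHn.
Qed.

Lemma thick_dotK f g n :
    src f = st 1 -> tgt f = st 1 -> src g = st 1 -> tgt g = st 1 ->
    crs 1 1 ∘ (f ⊗ f) = (f ⊗ f) ∘ crs 1 1 ->
    crs 1 1 ∘ (g ⊗ g) = (g ⊗ g) ∘ crs 1 1 ->
    f ∘ g = aid (st 1) -> thick_dot f n ∘ thick_dot g n = aid (st n).
Proof.
move=> sf tf sg tg cf cg e.
have [h1 _] := thick_dot_commP sf tf cf n.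
have [h2 _] := thick_dot_commP sg tg cg n.
apply: (@spls_mono n); rewrite ?endpointE ?tgt_mrgs //.
rewrite -acompA h1 acompA h2 -acompA tpow_comp ?sf ?tg // e acompf1 ?src_spls //.
have -> : wtpow (aid (st 1)) n = aid (ones n).
  by elim: n {h1 h2} => //= n ->; rewrite atens_id.
by rewrite acomp1f ?tgt_spls.
Qed.

(** * Dots through crossings of thick strands *)

Local Notation dot := (wdot D).
Local Notation dotV := (wdotV D).

(** The other half of thin (W4) with $c_{1,1}^{-1}$ composed on the left and $c_{1,1}$ on the
    right. *)
Lemma crs_dot11r : (dot ⊗ aid (st 1)) ∘ crs 1 1 = crsV 1 1 ∘ (aid (st 1) ⊗ dot).
Proof.
have := congr1 (fun f => crsV 1 1 ∘ f ∘ crs 1 1) (crs_dot11 D).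
rewrite -2!acompA wcrsVK !acompA wcrsVK acompf1 ?acomp1f //;
  by rewrite !endpointE ?src_dot ?tgt_dot.
Qed.

(** Passing one dot turns $c_{1,1}$ into $c_{1,1}^{-1}$, and passing the other turns it back. *)
Lemma crs_dot_dot : crs 1 1 ∘ (dot ⊗ dot) = (dot ⊗ dot) ∘ crs 1 1.
Proof.
have e1 : dot ⊗ dot = (dot ⊗ aid (st 1)) ∘ (aid (st 1) ⊗ dot).
  by rewrite -atens_comp ?src_dot ?tgt_dot // acompf1 ?acomp1f ?src_dot ?tgt_dot.
have e2 : dot ⊗ dot = (aid (st 1) ⊗ dot) ∘ (dot ⊗ aid (st 1)).
  by rewrite -atens_comp ?src_dot ?tgt_dot // acompf1 ?acomp1f ?src_dot ?tgt_dot.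
by rewrite {1}e1 e2 -acompA (crs_dot11 D) !acompA crs_dot11r.
Qed.

Lemma crs_dotV_dotV : crs 1 1 ∘ (dotV ⊗ dotV) = (dotV ⊗ dotV) ∘ crs 1 1.
Proof.
have e1 : (dot ⊗ dot) ∘ (dotV ⊗ dotV) = aid (tob (st 1) (st 1)).
  by rewrite -atens_comp ?src_dot ?tgt_dotV // wdotKV atens_id.
have e2 : (dotV ⊗ dotV) ∘ (dot ⊗ dot) = aid (tob (st 1) (st 1)).
  by rewrite -atens_comp ?src_dotV ?tgt_dot // wdotVK atens_id.
have := congr1 (fun f => (dotV ⊗ dotV) ∘ f ∘ (dotV ⊗ dotV)) crs_dot_dot.
rewrite !acompA e1 -!acompA e2 !acompA acompf1 ?src_crs // acomp1f.
  by move=> /esym.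
by rewrite endpointE tgt_crs.
Qed.

Definition ndot n := thick_dot dot n.
Definition ndotV n := thick_dot dotV n.

Lemma ndotKV n : ndot n ∘ ndotV n = aid (st n).
Proof.
by apply: thick_dotK; rewrite ?src_dot ?tgt_dot ?src_dotV ?tgt_dotV ?wdotKV //;
  [apply: crs_dot_dot | apply: crs_dotV_dotV].
Qed.

Lemma ndotVK n : ndotV n ∘ ndot n = aid (st n).
Proof.
by apply: thick_dotK; rewrite ?src_dot ?tgt_dot ?src_dotV ?tgt_dotV ?wdotVK //;
  [apply: crs_dotV_dotV | apply: crs_dot_dot].
Qed.

(** The mirrored sliding statement for $c_{b+1,a}$, with all crossings moved to the other side of
    the equation. *)
Lemma spl_crsV_rightn a b :
  wh [::] (spl b 1) [:: a] ∘ crsV b.+1 a =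
  wh [:: b] (crsV 1 a) [::] ∘ (wh [::] (crsV b a) [:: 1] ∘ wh [:: a] (spl b 1) [::]).
Proof.
have := congr1 (fun f => wh [:: b] (crsV 1 a) [::] ∘ (wh [::] (crsV b a) [:: 1] ∘ f)
  ∘ crsV b.+1 a) (spl_crs_leftr W a b).
rewrite !acompA wcrsKV acompf1 => [->|]; last by ends.
have eb : wh [::] (crsV b a) [:: 1] ∘ wh [::] (crs b a) [:: 1]
    = aid (ob [:: b; a; 1]).
  rewrite -wh_comp ?wcrsVK ?src_crsV ?tgt_crs //= /whisker !atens_id.
  by congr aid; ends.
have e1 : wh [:: b] (crsV 1 a) [::] ∘ wh [:: b] (crs 1 a) [::]
    = aid (ob [:: b; 1; a]).
  rewrite -wh_comp ?wcrsVK ?src_crsV ?tgt_crs //= /whisker !atens_id.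
  by congr aid; ends.
rewrite (chain1 _ eb) acomp1f; last by ends.
by rewrite (chain1 _ e1) acomp1f //; ends.
Qed.

Lemma spl_crsV_leftr a b :
  wh [:: b] (spl a 1) [::] ∘ crsV b a.+1 =
  wh [::] (crsV b a) [:: 1] ∘ (wh [:: a] (crsV b 1) [::] ∘ wh [::] (spl a 1) [:: b]).
Proof.
have := congr1 (fun f => wh [::] (crsV b a) [:: 1] ∘ (wh [:: a] (crsV b 1) [::] ∘ f)
  ∘ crsV b a.+1) (spl_crs_rightn a b).
rewrite !acompA wcrsKV acompf1 => [->|]; last by ends.
have eb : wh [:: a] (crsV b 1) [::] ∘ wh [:: a] (crs b 1) [::]
    = aid (ob [:: a; b; 1]).
  rewrite -wh_comp ?wcrsVK ?src_crsV ?tgt_crs //= /whisker !atens_id.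
  by congr aid; ends.
have e1 : wh [::] (crsV b a) [:: 1] ∘ wh [::] (crs b a) [:: 1]
    = aid (ob [:: b; a; 1]).
  rewrite -wh_comp ?wcrsVK ?src_crsV ?tgt_crs //= /whisker !atens_id.
  by congr aid; ends.
rewrite (chain1 _ eb) acomp1f; last by ends.
by rewrite (chain1 _ e1) acomp1f //; ends.
Qed.

Lemma ndot_hom n : ishom W (ndot n) [:: n] [:: n].
Proof. by apply: thick_dot_hom. Qed.

Lemma src_ndot n : src (ndot n) = st n. Proof. exact: src_thick_dot. Qed.
Lemma tgt_ndot n : tgt (ndot n) = st n. Proof. exact: tgt_thick_dot. Qed.

Definition crs_ndot_at a b :=
  crs a b ∘ wh [::] (ndot a) [:: b] = wh [:: b] (ndot a) [::] ∘ crsV b a.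

Lemma crs_ndot_wh s t a b : crs_ndot_at a b ->
  wh s (crs a b) t ∘ wh s (ndot a) (b :: t) =
  wh (rcons s b) (ndot a) t ∘ wh s (crsV b a) t.
Proof.
move=> e; have := congr1 (fun f => wh s f t) e.
rewrite !wh_comp ?wh_wh ?cats0 ?cats1 //.
  by rewrite src_wh src_ndot tgt_crsV; ends.
by rewrite tgt_wh tgt_ndot src_crs; ends.
Qed.

Lemma crs_ndot11 : crs_ndot_at 1 1.
Proof.
rewrite /crs_ndot_at /ndot thick_dot1 ?src_dot ?tgt_dot //.
by rewrite -whl1 -whr1 crs_dot11.
Qed.

(** Once the right strand is split, the thin dot passes its two pieces one after the other. Each
    passage inverts one crossing, and the inverted crossings reassemble by [spl_crsV_rightn]. *)
Lemma crs_ndot_right b : crs_ndot_at 1 b -> crs_ndot_at 1 b.+1.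
Proof.
move=> IHb; rewrite /crs_ndot_at.
apply: (@spl_mono [::] b 1 [:: 1]).
- by rewrite addn1; ends.
- by rewrite addn1 endpointE tgt_wh tgt_ndot; ends.
rewrite -[LHS]acompA spl_crs_rightn !acompA.
rewrite (exch (x := [::]) (z := [::]) (ndot_hom 1)
  (spl_hom W (esym (addn1 b))) (erefl _) (erefl _)) /=.
rewrite (chain _ (crs_ndot_wh _ _ IHb)) (chain _ (crs_ndot_wh _ _ crs_ndot11)).
rewrite -spl_crsV_rightn.
by rewrite -(exchC (x := [::]) (z := [::]) _ (spl_hom W (esym (addn1 b)))
  (ndot_hom 1) (erefl _) (erefl _)).
Qed.

(** Here the split cuts the dotted strand, and with it the dot, into dots on $a$ and on $1$, which
    pass the strand [b] separately. *)
Lemma crs_ndot_left a b : crs_ndot_at 1 b -> crs_ndot_at a b -> crs_ndot_at a.+1 b.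
Proof.
move=> H1 IHa; rewrite /crs_ndot_at.
have espl s t : wh s (spl a 1) t ∘ wh s (ndot a.+1) t =
    wh s (ndot a) (1 :: t) ∘ (wh (rcons s a) (ndot 1) t ∘ wh s (spl a 1) t).
  by rewrite -[in ndot a.+1]addn1; apply: thick_dot_spl_wh; 
    rewrite ?src_dot ?tgt_dot //; apply: crs_dot_dot.
apply: (@spl_mono [:: b] a 1 [::]).
- by rewrite addn1; ends.
- by rewrite addn1 endpointE tgt_wh tgt_ndot; ends.
rewrite -[LHS]acompA spl_crs_leftr !acompA espl.
rewrite (exchC (x := [::]) (z := [::]) _ (ndot_hom a) (crs_hom W 1 b)
  (erefl _) (erefl _)) /=.
rewrite (chain _ (crs_ndot_wh [:: a] [::] H1)) (chain _ (crs_ndot_wh _ _ IHa)) /=.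
rewrite -(exchC (x := [::]) (z := [::]) _ (crsV_hom b a) (ndot_hom 1)
  (erefl _) (erefl _)) /=.
by rewrite -spl_crsV_leftr (chain _ (espl _ _)) !acompA.
Qed.

Lemma crs_ndotP a b : crs_ndot_at a b.
Proof.
have H1 c : crs_ndot_at 1 c.
  elim: c => [|c IHc]; last exact: crs_ndot_right.
  rewrite /crs_ndot_at crsn0 wcrsV0n wh0r wh0l acompf1 ?acomp1f //.
    by rewrite tgt_wh tgt_ndot /= tob1x tobx1.
  by rewrite src_wh src_ndot /= tob1x tobx1.
elim: a => [|a IHa]; last exact: crs_ndot_left.
rewrite /crs_ndot_at crs0n wcrsVn0 /ndot thick_dot0 !wh_id /=.
by rewrite !acompf1 ?st0 //= ?tob1x ?tobx1.
Qed.

Lemma crs_ndotl a b :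
  crs a b ∘ (ndot a ⊗ aid (st b)) = (aid (st b) ⊗ ndot a) ∘ crsV b a.
Proof. by rewrite whr1 whl1 crs_ndotP. Qed.

Lemma crs_ndotr a b :
  (ndot b ⊗ aid (st a)) ∘ crs a b = crsV b a ∘ (aid (st a) ⊗ ndot b).
Proof.
have := congr1 (fun f => crsV b a ∘ f ∘ crs a b) (crs_ndotl b a).
rewrite -2!acompA wcrsVK !acompA wcrsVK acompf1 ?acomp1f //.
  by rewrite tgt_acomp tgt_atens tgt_ndot.
by rewrite src_atens src_ndot.
Qed.

Lemma spl_ndot a b : spl a b ∘ ndot (a + b) = (ndot a ⊗ ndot b) ∘ spl a b.
Proof.
by apply: thick_dot_spl; rewrite ?src_dot ?tgt_dot //; apply: crs_dot_dot.
Qed.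

Lemma mrg_ndot a b : ndot (a + b) ∘ mrg a b = mrg a b ∘ (ndot a ⊗ ndot b).
Proof.
by apply: thick_dot_mrg; rewrite ?src_dot ?tgt_dot //; apply: crs_dot_dot.
Qed.
End Dots.

(** * The web category with thin dots *)

Section Denotation.
Local Open Scope ring_scope.
Import GRing.Theory.
Variables (k : fieldType) (P : presentation k).
Local Notation C := (presented P).
Local Notation ty := (typed (@gsrc k P) (@gtgt k P)).

Definition pmor x y f (Hf : ty f x y) : arrow C :=
  toarr (mor Hf : hom (x : C) y).

(** Since the operations on arrows are total, untyped expressions can be interpreted without a
    typing derivation; on typed ones the result is their class, by [den_pmor]. *)
Fixpoint den (f : expr k (gob P) (gmor P)) : arrow C :=
  match f with
  | Gen g => pmor (typed_gen _ _ _ g)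
  | Id x => aid (x : C)
  | Comp f g => den f ∘ den g
  | Tens f g => den f ⊗ den g
  | Zero x y => pmor (typed_zero _ _ _ x y)
  | Add f g => den f ⊞ den g
  | Scale a f => a ⊙ den f
  end.

Lemma den_pmor x y f (Hf : ty f x y) : den f = pmor Hf.
Proof.
have pmor_irr x' y' f' (H H' : ty f' x' y') : pmor H = pmor H'.
  by congr toarr; apply/mor_eqP/eqm_refl.
(* The induction runs over one derivation while a second, arbitrary one is kept in the goal;
   [pmor_irr] identifies the resulting classes. *)
elim: Hf (Hf) => {f x y} /= [g|x|f g x y z Hf IHf Hg IHg|
    f g x y x' y' Hf IHf Hg IHg|x y|f g x y Hf IHf Hg IHg|a f x y Hf IHf] H.
- exact: pmor_irr.
- by rewrite (pmor_irr _ _ _ H (typed_id _ _ _ x)).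
- rewrite (IHf Hf) (IHg Hg) (pmor_irr _ _ _ H (typed_comp Hf Hg)).
  by rewrite /pmor acompE /= pcompE.
- rewrite (IHf Hf) (IHg Hg) (pmor_irr _ _ _ H (typed_tens Hf Hg)).
  by rewrite /pmor atensE /= ptensE.
- exact: pmor_irr.
- rewrite (IHf Hf) (IHg Hg) (pmor_irr _ _ _ H (typed_add Hf Hg)).
  by rewrite /pmor aaddE /= -paddE.
- rewrite (IHf Hf) (pmor_irr _ _ _ H (typed_scale a Hf)).
  by rewrite /pmor ascaleE /= -pscaleE.
Qed.

Lemma src_den x y f : ty f x y -> src (den f) = x.
Proof. by move=> Hf; rewrite (den_pmor Hf). Qed.

Lemma tgt_den x y f : ty f x y -> tgt (den f) = y.
Proof. by move=> Hf; rewrite (den_pmor Hf). Qed.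

Lemma eqm_den x y f g : eqm x y f g -> den f = den g.
Proof.
move=> e; have [Hf Hg] := eqm_typed e.
by rewrite (den_pmor Hf) (den_pmor Hg); congr toarr; apply/mor_eqP.
Qed.

(** With [eqm_den], this makes derivability in the presentation the same as equality of arrows, so
    the arrow calculus can prove relations. *)
Lemma den_eqm x y f g : ty f x y -> ty g x y -> den f = den g -> eqm x y f g.
Proof.
move=> Hf Hg; rewrite (den_pmor Hf) (den_pmor Hg) => e.
by apply/(mor_eqP Hf Hg); move: e => /toarr_inj.
Qed.

Lemma den_big (I : eqType) x y (r : seq I) (Q : pred I) F :
    (forall i, i \in r -> Q i -> ty (F i) x y) ->
  den (\big[@Add _ _ _/Zero x y]_(i <- r | Q i) F i) =
  toarr (\sum_(i <- r | Q i) coe (x : C) y (den (F i))).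
Proof.
elim: r => [|i r IHr] HF; first by rewrite !big_nil.
have {}IHr := IHr (fun j jr => HF j (@mem_behead _ (i :: r) j jr)).
rewrite !big_cons; case: ifP => // Qi; have Hi := HF i (mem_head i r) Qi.
by rewrite -/den /= IHr (den_pmor Hi) coeE aaddE.
Qed.
End Denotation.

Lemma asum_toarr (k : fieldType) (C : smcat k) x y F n : homog x y F n ->
  asum F n = toarr (\sum_(0 <= i < n.+1) coe x y (F i : arrow C))%R.
Proof.
elim: n F => [|n IHn] F hF.
  have [s t] := hF 0 isT; rewrite big_nat1 /=.
  by have [u ->] := arrow_homP s t; rewrite coeE.
have [s t] := hF 0 isT; rewrite big_nat_recl //= (IHn _ (homogS hF)).
by have [u ->] := arrow_homP s t; rewrite coeE aaddE.
Qed.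

(** * Thin webs as an instance of the web calculus *)

Section Instance.
Variables (k : fieldType) (q : k).
Hypothesis qint_neq0 : forall n, 0 < n -> (qint q n != 0)%R.
Local Notation P := (dweb'_presentation q).
Local Notation C := (presented P).
Local Notation den := (@den k P).
Local Notation merge a b := (den (mrg a b)).
Local Notation split a b := (den (spl a b)).
Local Notation cross a b := (den (crs k thin_dots a b)).
Local Notation crossV a b := (den (crsV k thin_dots a b)).
Local Notation str a := (strand a : C).
Implicit Types a b c n : nat.

Lemma merge0n a : merge 0 a = aid (str a). Proof. by []. Qed.
Lemma mergen0 a : merge a 0 = aid (str a).
Proof. by case: a => [|a] //=; rewrite addn0. Qed.
Lemma split0n a : split 0 a = aid (str a). Proof. by []. Qed.
Lemma splitn0 a : split a 0 = aid (str a).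
Proof. by case: a => [|a] //=; rewrite addn0. Qed.
Lemma cross0n a : cross 0 a = aid (str a). Proof. by []. Qed.
Lemma crossn0 a : cross a 0 = aid (str a).
Proof. by case: a => [|a] //=; rewrite addn0. Qed.
Lemma crossV0n a : crossV 0 a = aid (str a). Proof. by []. Qed.
Lemma crossVn0 a : crossV a 0 = aid (str a).
Proof. by case: a => [|a] //=; rewrite addn0. Qed.

Lemma src_merge a b : src (merge a b) = tob (str a) (str b).
Proof. exact: (@src_den _ P _ _ _ (typed_mrg _ _ _ _)). Qed.
Lemma tgt_merge a b : tgt (merge a b) = str (a + b).
Proof. exact: (@tgt_den _ P _ _ _ (typed_mrg _ _ _ _)). Qed.
Lemma src_split a b : src (split a b) = str (a + b).
Proof. exact: (@src_den _ P _ _ _ (typed_spl _ _ _ _)). Qed.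
Lemma tgt_split a b : tgt (split a b) = tob (str a) (str b).
Proof. exact: (@tgt_den _ P _ _ _ (typed_spl _ _ _ _)). Qed.
Lemma src_cross a b : src (cross a b) = tob (str a) (str b).
Proof. exact: (@src_den _ P _ _ _ (typed_crs _ _ _ _)). Qed.
Lemma tgt_cross a b : tgt (cross a b) = tob (str b) (str a).
Proof. exact: (@tgt_den _ P _ _ _ (typed_crs _ _ _ _)). Qed.
Lemma src_crossV a b : src (crossV a b) = tob (str b) (str a).
Proof. exact: (@src_den _ P _ _ _ (typed_crsV _ _ _ _)). Qed.
Lemma tgt_crossV a b : tgt (crossV a b) = tob (str a) (str b).
Proof. exact: (@tgt_den _ P _ _ _ (typed_crsV _ _ _ _)). Qed.

Lemma den_rel x y f g : web_rel q (dots := thin_dots) x y f g -> den f = den g.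
Proof. by move=> H; apply/eqm_den/(@eqm_rel _ P); exact: H. Qed.

Lemma splitA a b c :
  (split a b ⊗ aid (str c)) ∘ split (a + b) c =
  (aid (str a) ⊗ split b c) ∘ split a (b + c).
Proof.
case: a => [|a].
  rewrite !split0n atens_id acomp1f ?tgt_split // acompf1 ?atens1f //.
  by rewrite ?src_atens src_split.
case: b => [|b].
  by rewrite splitn0 split0n !atens_id !acomp1f ?addn0 // tgt_split.
case: c => [|c].
  rewrite splitn0 addn0 !splitn0 atens_id acompf1 ?atensf1 ?src_split //.
  by rewrite acomp1f // tgt_split.
exact: den_rel (W1_split _ _ (thickS a) (thickS b) (thickS c)).
Qed.

Lemma mergeA a b c :
  merge (a + b) c ∘ (merge a b ⊗ aid (str c)) =
  merge a (b + c) ∘ (aid (str a) ⊗ merge b c).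
Proof.
case: a => [|a].
  rewrite !merge0n atens_id acompf1 ?src_merge // acomp1f ?atens1f //.
  by rewrite ?tgt_atens tgt_merge.
case: b => [|b].
  by rewrite mergen0 merge0n !atens_id !acompf1 ?addn0 // src_merge.
case: c => [|c].
  rewrite mergen0 addn0 !mergen0 atens_id acomp1f ?atensf1 ?tgt_merge //.
  by rewrite acompf1 // src_merge.
exact: den_rel (W1_merge _ _ (thickS a) (thickS b) (thickS c)).
Qed.

Lemma qfact0 : qfact q 0 = 1%R.
Proof. by rewrite /qfact big_nil. Qed.

Lemma qbinomn0 n : qbinom q n 0 = 1%R.
Proof. by rewrite /qbinom big_ord0 qfact0 GRing.divr1. Qed.

Lemma qbinomnn n : qbinom q n n = 1%R.
Proof.
rewrite /qbinom (_ : (\prod_(i < n) qint q (n - i))%R = qfact q n).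
  by rewrite GRing.divff // qfact_neq0.
rewrite /qfact big_add1 /= big_mkord (reindex_inj rev_ord_inj) /=.
by apply: eq_bigr => i _; rewrite subKn.
Qed.

Lemma merge_split a b :
  merge a b ∘ split a b = qbinom q (a + b) a ⊙ aid (str (a + b)).
Proof.
case: a => [|a].
  by rewrite merge0n ?split0n qbinomn0 ascale1 acomp1f.
case: b => [|b].
  by rewrite mergen0 ?splitn0 addn0 qbinomnn ascale1 acomp1f.
exact: den_rel (W3 _ _ (thickS a) (thickS b)).
Qed.

Lemma crossVK a b : crossV a b ∘ cross a b = aid (tob (str a) (str b)).
Proof.
case: a => [|a].
  by rewrite crossV0n ?cross0n acomp1f // tob1x.
case: b => [|b].
  by rewrite crossVn0 ?crossn0 acomp1f // tobx1.
exact: den_rel (crsVK _ _ (thickS a) (thickS b)).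
Qed.

Lemma crossKV a b : cross a b ∘ crossV a b = aid (tob (str b) (str a)).
Proof.
case: a => [|a].
  by rewrite crossV0n ?cross0n acomp1f // tobx1.
case: b => [|b].
  by rewrite crossVn0 ?crossn0 acomp1f // tob1x.
exact: den_rel (crsKV _ _ (thickS a) (thickS b)).
Qed.

Local Open Scope ring_scope.
(** Reading the formal sums in a hom space gives access to the reindexing lemmas for finite sums. *)
Lemma den_ladders a b c d : (a + c = b + d)%N ->
  den (ladders q thin_dots a b c d) = toarr (
    \sum_(0 <= s < (minn a b).+1) \sum_(0 <= t < (minn c d).+1 | (t + a == d + s)%N)
      coe (tob (str a) (str c)) (tob (str b) (str d))
        (q ^+ (s * t) ⊙ den (ladder k thin_dots a b c s t))).
Proof.
move=> e.
have Hin s : (s < (minn a b).+1)%N ->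
    forall t, t \in index_iota 0 (minn c d).+1 -> (t + a == d + s)%N ->
    typed (@web_src thin_dots) (@web_tgt thin_dots)
      (Scale (q ^+ (s * t)) (ladder k thin_dots a b c s t))
      (strand a ++ strand c) (strand b ++ strand d).
  rewrite ltnS leq_min => /andP[sa sb] t; rewrite mem_index_iota ltnS leq_min.
  by move=> /andP[_ /andP[tc td]] /eqP et; apply/typed_scale/typed_ladder.
have Hout s : s \in index_iota 0 (minn a b).+1 -> true ->
    typed (@web_src thin_dots) (@web_tgt thin_dots)
     (\big[@Add _ _ _/Zero (strand a ++ strand c) (strand b ++ strand d)]_
        (0 <= t < (minn c d).+1 | (t + a == d + s)%N)
      Scale (q ^+ (s * t)) (ladder k thin_dots a b c s t))
      (strand a ++ strand c) (strand b ++ strand d).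
  rewrite mem_index_iota => /andP[_ ls] _; rewrite big_seq_cond.
  apply: (big_rec (fun h => typed _ _ h _ _)) => [|t g /andP[tr et] Hg].
    exact: typed_zero.
  by apply: typed_add Hg; apply: Hin.
rewrite /ladders (den_big (P := P) Hout); congr toarr.
apply: eq_big_seq => s; rewrite mem_index_iota => /andP[_ ls].
by rewrite (den_big (P := P) (Hin s ls)) coeE.
Qed.

Lemma split_mergeW2 a b c d : (a + c = b + d)%N ->
  (0 < a)%N -> (0 < b)%N -> (0 < c)%N -> (0 < d)%N ->
  split b d ∘ merge a c = den (ladders q thin_dots a b c d).
Proof.
case: a b c d => [|a] [|b] [|c] [|d] // e _ _ _ _.
exact: den_rel (@W2 _ _ _ (thickS a) (thickS b) (thickS c) (thickS d) e).
Qed.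

Lemma den_ladder a b c s t :
  den (ladder k thin_dots a b c s t) =
  (merge s (b - s) ⊗ merge (a - s) t)
    ∘ (aid (str s) ⊗ cross (a - s) (c - t) ⊗ aid (str t))
    ∘ (split s (a - s) ⊗ split (c - t) t).
Proof. by []. Qed.

Definition endE := (src_merge, tgt_merge, src_split, tgt_split, src_cross,
  tgt_cross).

(** With target $(b,a+n)$ and source $(a,b+n)$ the side condition of (W2) forces $t=s+n$, so the
    double sum collapses. If $a$ or $b$ is 0, both sides reduce to a single split or merge. *)
Lemma split_mergeR a b n :
  split b (a + n) ∘ merge a (b + n) =
  asum (fun s => q ^+ (s * (s + n)) ⊙
    ((merge s (b - s) ⊗ merge (a - s) (s + n))
      ∘ (aid (str s) ⊗ cross (a - s) (b - s) ⊗ aid (str (s + n)))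
      ∘ (split s (a - s) ⊗ split (b - s) (s + n)))) (minn a b).
Proof.
have [a0|a_gt0] := posnP a.
  rewrite a0 min0n /= mul0n GRing.expr0 ascale1 !subn0 !add0n.
  rewrite !atens_id !(atens1f _ (erefl smunit)).
  by rewrite acompf1 ?endE // acomp1f ?endE // acomp1f ?endE.
have [b0|b_gt0] := posnP b.
  rewrite b0 minn0 /= mul0n GRing.expr0 ascale1 !subn0 !add0n.
  rewrite !(merge0n, split0n, crossn0) !atens_id !(atens1f _ (erefl smunit)).
  by rewrite acomp1f ?endE // acompf1 ?endE // acompf1 ?endE //.
rewrite split_mergeW2 ?den_ladders; try lia.
rewrite (@asum_toarr _ _ (tob (str a) (str (b + n))) (tob (str b) (str (a + n))));
  last first.
  move=> s le_s; split; rewrite ?(endpointE, endE) //.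
    by apply: f_equal2; apply: f_equal; lia.
  by apply: f_equal2; apply: f_equal; lia.
congr toarr; apply: eq_big_nat => s /andP[_ le_s].
rewrite (eq_bigl (fun t => t == s + n)%N) => [|t]; last by lia.
rewrite big_nat1_eq ifT; last by lia.
by rewrite den_ladder subnDr.
Qed.

Lemma split_mergeL a b n :
  split (b + n) a ∘ merge (a + n) b =
  asum (fun t => q ^+ (t * (t + n)) ⊙
    ((merge (t + n) (b - t) ⊗ merge (a - t) t)
      ∘ (aid (str (t + n)) ⊗ cross (a - t) (b - t) ⊗ aid (str t))
      ∘ (split (t + n) (a - t) ⊗ split (b - t) t))) (minn a b).
Proof.
have [a0|a_gt0] := posnP a.
  rewrite a0 min0n /= mul0n GRing.expr0 ascale1 !subn0 !add0n.
  rewrite !(mergen0, splitn0, cross0n, merge0n) !atens_id !(atensf1 _ (erefl smunit)).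
  rewrite !tobx1 acomp1f ?endE 1?addnC // !acompf1 ?endE //.
have [b0|b_gt0] := posnP b.
  rewrite b0 minn0 /= mul0n GRing.expr0 ascale1 !subn0 !add0n.
  rewrite !(mergen0, splitn0, crossn0) !atens_id !(atensf1 _ (erefl smunit)).
  by rewrite !tobx1 acompf1 ?endE 1?addnC // acompA !acomp1f ?endE.
rewrite split_mergeW2 ?den_ladders; try lia.
rewrite (@asum_toarr _ _ (tob (str (a + n)) (str b)) (tob (str (b + n)) (str a)));
  last first.
  move=> s le_s; split; rewrite ?(endpointE, endE) //.
    by apply: f_equal2; apply: f_equal; lia.
  by apply: f_equal2; apply: f_equal; lia.
(* Now $s=t+n$ is determined by $t$, so the sum over $s$ has to become the inner one. *)
congr toarr; rewrite (exchange_big_dep xpredT) // minnC.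
apply: eq_big_nat => t /andP[_ le_t].
rewrite (eq_bigl (fun s => s == t + n)%N) => [|s]; last by lia.
rewrite big_nat1_eq ifT; last by lia.
by rewrite den_ladder !subnDr mulnC.
Qed.

Definition thin_webs : webs q C := @Webs k q C (fun a => str a)
  (fun a b => merge a b) (fun a b => split a b) (fun a b => cross a b)
  erefl src_merge tgt_merge src_split tgt_split src_cross tgt_cross
  merge0n mergen0 split0n splitn0 cross0n crossn0 splitA split_mergeR split_mergeL.

Local Notation x1 := (dot thin (isT : thin_dots thin)).
Local Notation x1V := (dotV thin (isT : thin_dots thin)).

Definition thin_dotted : dotted thin_webs.
Proof.
apply: (@Dotted k q C thin_webs (fun a b => crossV a b) (den x1) (den x1V)).
- exact: src_crossV.
- exact: tgt_crossV.
- exact: (@src_den _ P _ _ _ (typed_dot _ _ thin _)).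
- exact: (@tgt_den _ P _ _ _ (typed_dot _ _ thin _)).
- exact: (@src_den _ P _ _ _ (typed_dotV _ _ thin _)).
- exact: (@tgt_den _ P _ _ _ (typed_dotV _ _ thin _)).
- exact: crossVK.
- exact: crossKV.
- exact: den_rel (Defs.dotVK q (a := thin) isT).
- exact: den_rel (Defs.dotKV q (a := thin) isT).
- exact: mergeA.
- exact: merge_split.
- exact: den_rel (W4_left q (a := thin) (b := thin) isT isT).
Defined.

Lemma den_explode f a : den (explode f a) =
  wmrgs thin_webs a ∘ wtpow (den f) a ∘ wspls thin_webs a.
Proof.
have em : den (Defs.mrgs k thin_dots (nseq a 1%N)) = wmrgs thin_webs a.
  elim: a => //= a IHa; rewrite IHa sumn_nseq mul1n.
  by [].
have es : den (Defs.spls k thin_dots (nseq a 1%N)) = wspls thin_webs a.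
  elim: a {em} => //= a IHa; rewrite IHa sumn_nseq mul1n.
  by [].
have et : den (Defs.tpow f a) = wtpow (den f) a by elim: a {em es} => //= a ->.
by rewrite -em -es -et.
Qed.
End Instance.

(** * The mutually inverse functors *)

Section ExprMap.
Variables (k : fieldType) (I G1 G2 : Type) (phi : G1 -> expr k I G2).

Fixpoint emap (f : expr k I G1) : expr k I G2 :=
  match f with
  | Gen g => phi g
  | Id x => Id x
  | Comp f g => Comp (emap f) (emap g)
  | Tens f g => Tens (emap f) (emap g)
  | Zero x y => Zero x y
  | Add f g => Add (emap f) (emap g)
  | Scale a f => Scale a (emap f)
  end.

Lemma typed_emap (s1 t1 : G1 -> seq I) (s2 t2 : G2 -> seq I) :
    (forall g, typed s2 t2 (phi g) (s1 g) (t1 g)) ->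
  forall f x y, typed s1 t1 f x y -> typed s2 t2 (emap f) x y.
Proof.
move=> Hphi f x y; by elim=> {f x y} /= *; [exact: Hphi|..]; eauto using typed.
Qed.
End ExprMap.

Section PresentationFunctor.
Local Open Scope ring_scope.
Variables (k : fieldType) (I G1 G2 : Type).
Variables (s1 t1 : G1 -> seq I) (s2 t2 : G2 -> seq I).
Variable r1 : seq I -> seq I -> expr k I G1 -> expr k I G1 -> Prop.
Variable r2 : seq I -> seq I -> expr k I G2 -> expr k I G2 -> Prop.
Hypothesis H1 : forall x y f g, r1 x y f g -> typed s1 t1 f x y /\ typed s1 t1 g x y.
Hypothesis H2 : forall x y f g, r2 x y f g -> typed s2 t2 f x y /\ typed s2 t2 g x y.
Local Notation P1 := (Presentation H1).
Local Notation P2 := (Presentation H2).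
Variable phi : G1 -> expr k I G2.
Hypothesis phi_typed : forall g, typed s2 t2 (phi g) (s1 g) (t1 g).
Hypothesis phi_rel : forall x y f g, r1 x y f g ->
  @eqm k P2 x y (emap phi f) (emap phi g).

Let phi_ty := typed_emap phi_typed.

(** Substitution of generators commutes with every constructor of expressions, so each structural
    rule is carried to itself; [phi_rel] supplies the generating relations. *)
Lemma emap_eqm x y f g :
  @eqm k P1 x y f g -> @eqm k P2 x y (emap phi f) (emap phi g).
Proof.
have ty' f' x' y' : typed s1 t1 f' x' y' -> typed s2 t2 (emap phi f') x' y'.
  exact: phi_ty.
elim=> {x y f g} /= *; [exact: phi_rel|..];
  first [
    solve [eapply eqm_refl; eauto] |
    solve [eapply eqm_sym; eauto] |
    solve [eapply eqm_trans; eauto] |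
    solve [eapply eqm_comp; eauto] |
    solve [eapply eqm_tens; eauto] |
    solve [eapply eqm_add; eauto] |
    solve [eapply eqm_scale; eauto] |
    solve [eapply eqm_addA; eauto] |
    solve [eapply eqm_addC; eauto] |
    solve [eapply eqm_add0; eauto] |
    solve [eapply eqm_scale0; eauto] |
    solve [eapply eqm_scale1; eauto] |
    solve [eapply eqm_scaleA; eauto] |
    solve [eapply eqm_scaleDr; eauto] |
    solve [eapply eqm_scaleDl; eauto] |
    solve [eapply eqm_compA; eauto] |
    solve [eapply eqm_comp1m; eauto] |
    solve [eapply eqm_compm1; eauto] |
    solve [eapply eqm_compDl; eauto] |
    solve [eapply eqm_compDr; eauto] |
    solve [eapply eqm_compZl; eauto] |
    solve [eapply eqm_compZr; eauto] |
    solve [eapply eqm_tensA; eauto] |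
    solve [eapply eqm_tens1m; eauto] |
    solve [eapply eqm_tensm1; eauto] |
    solve [eapply eqm_tens_id; eauto] |
    solve [eapply eqm_tens_comp; eauto] |
    solve [eapply eqm_tensDl; eauto] |
    solve [eapply eqm_tensDr; eauto] |
    solve [eapply eqm_tensZl; eauto] |
    solve [eapply eqm_tensZr; eauto]].
Qed.

Definition presented_mor (x y : seq I) (u : phom (P := P1) x y) :
    phom (P := P2) x y :=
  mor (P := P2) (phi_ty (rexprP u)).

Lemma presented_morE x y f (Hf : typed s1 t1 f x y) :
  presented_mor (mor (P := P1) Hf) = mor (P := P2) (phi_ty Hf).
Proof. by apply/mor_eqP/emap_eqm/rexpr_mor. Qed.

Lemma presented_mor_linear x y : linear (@presented_mor x y).
Proof.
move=> a; elim/mor_ind=> f Hf; elim/mor_ind=> g Hg.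
rewrite !phom_addE !phom_scaleE !(@pE k P1) !presented_morE !(@pE k P2).
by apply/mor_eqP/eqm_refl/typed_add; [apply/typed_scale|]; apply: phi_ty.
Qed.

Lemma presented_mor_id x : presented_mor (pid (P := P1) x) = pid (P := P2) x.
Proof. by rewrite presented_morE; apply/mor_eqP/eqm_refl/typed_id. Qed.

Lemma presented_mor_comp x y z (u : phom (P := P1) y z) (v : phom (P := P1) x y) :
  presented_mor (pcomp u v) = pcomp (presented_mor u) (presented_mor v).
Proof.
elim/mor_ind: u => f Hf; elim/mor_ind: v => g Hg.
rewrite !(@pE k P1) !presented_morE !(@pE k P2); apply/mor_eqP/eqm_refl.
exact: typed_comp (phi_ty Hf) (phi_ty Hg).
Qed.

Lemma presented_mor_tens x y x' y'
    (u : phom (P := P1) x y) (v : phom (P := P1) x' y') :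
  presented_mor (ptens u v) = ptens (presented_mor u) (presented_mor v).
Proof.
elim/mor_ind: u => f Hf; elim/mor_ind: v => g Hg.
rewrite !(@pE k P1) !presented_morE !(@pE k P2); apply/mor_eqP/eqm_refl.
exact: typed_tens (phi_ty Hf) (phi_ty Hg).
Qed.

(** Both presentations share the alphabet [I] definitionally, so the functor is the identity on
    objects and strictness on objects holds by reflexivity. *)
Definition presented_functor : smfunctor (presented P1) (presented P2) :=
  @SMFunctor k (presented P1) (presented P2) id presented_mor
    presented_mor_linear presented_mor_id presented_mor_comp erefl
    (fun _ _ => erefl)
    (fun x y x' y' u v =>
       congr1 (@arr k _ (@plmod k P2) _ _) (presented_mor_tens u v)).

End PresentationFunctor.

Section EmapInverse.
Variables (k : fieldType) (P : presentation k) (G2 : Type).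
Variables (phi : gmor P -> expr k (gob P) G2) (psi : G2 -> expr k (gob P) (gmor P)).
Hypothesis phiK : forall g, eqm (gsrc g) (gtgt g) (emap psi (phi g)) (Gen g).

Lemma emapK f x y : typed (@gsrc k P) (@gtgt k P) f x y ->
  eqm x y (emap psi (emap phi f)) f.
Proof.
elim=> {f x y} /=.
- exact: phiK.
- by move=> x; apply/eqm_refl/typed_id.
- by move=> f g x y z _ IHf _ IHg; apply: eqm_comp IHf IHg.
- by move=> f g x y x' y' _ IHf _ IHg; apply: eqm_tens IHf IHg.
- by move=> x y; apply/eqm_refl/typed_zero.
- by move=> f g x y _ IHf _ IHg; apply: eqm_add IHf IHg.
- by move=> a f x y _ IHf; apply: eqm_scale IHf.
Qed.
End EmapInverse.

(** * Translations that fix merges, splits and crossings *)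

Section WebMap.
Variables (k : fieldType) (q : k) (d1 d2 : pred nat).
Variable chi : webgen d1 -> expr k thick (webgen d2).
Hypothesis chi_merge : forall a b, chi (GMerge a b) = Gen (GMerge a b).
Hypothesis chi_split : forall a b, chi (GSplit a b) = Gen (GSplit a b).
Hypothesis chi_cross : forall a b, chi (GCross a b) = Gen (GCross a b).
Hypothesis chi_crossV : forall a b, chi (GCrossV a b) = Gen (GCrossV a b).
Local Notation emap := (emap chi).

Lemma emap_mrg a b : emap (mrg a b) = mrg a b.
Proof. by case: a b => [|a] [|b] //=. Qed.
Lemma emap_spl a b : emap (spl a b) = spl a b.
Proof. by case: a b => [|a] [|b] //=. Qed.
Lemma emap_crs a b : emap (crs k d1 a b) = crs k d2 a b.
Proof. by case: a b => [|a] [|b] //=. Qed.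
Lemma emap_crsV a b : emap (crsV k d1 a b) = crsV k d2 a b.
Proof. by case: a b => [|a] [|b] //=. Qed.

Lemma emap_mrgs s : emap (mrgs k d1 s) = mrgs k d2 s.
Proof.
elim: s => [//|a s IHs].
rewrite -[RHS]/(Comp (mrg a (sumn s)) (Tens (Id (strand a)) (mrgs k d2 s))).
by rewrite -IHs -emap_mrg.
Qed.

Lemma emap_spls s : emap (spls k d1 s) = spls k d2 s.
Proof.
elim: s => [//|a s IHs].
rewrite -[RHS]/(Comp (Tens (Id (strand a)) (spls k d2 s)) (spl a (sumn s))).
by rewrite -IHs -emap_spl.
Qed.

Lemma emap_explode f a : emap (explode f a) = explode (emap f) a.
Proof.
have et : emap (tpow f a) = tpow (emap f) a by elim: a => //= a ->.
by rewrite /explode -emap_mrgs -emap_spls -et.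
Qed.

Lemma emap_ladders a b c d : emap (ladders q d1 a b c d) = ladders q d2 a b c d.
Proof.
have addE : {morph emap : f g / Add f g} by [].
rewrite /ladders (big_morph _ addE erefl); apply: eq_bigr => s _.
rewrite (big_morph _ addE erefl); apply: eq_bigr => t _.
by rewrite /ladder /= !emap_mrg !emap_spl emap_crs.
Qed.

Variable rel : seq thick -> seq thick ->
  expr k thick (webgen d2) -> expr k thick (webgen d2) -> Prop.
Hypothesis web_rel_sub : forall x y f g, web_rel q x y f g -> rel x y f g.
Hypothesis rel_dotVK : forall (a : thick) Da, rel (strand a) (strand a)
  (Comp (chi (GDotV a Da)) (chi (GDot a Da))) (Id (strand a)).
Hypothesis rel_dotKV : forall (a : thick) Da, rel (strand a) (strand a)
  (Comp (chi (GDot a Da)) (chi (GDotV a Da))) (Id (strand a)).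
Hypothesis rel_W4_left : forall (a b : thick) Da, d1 b ->
  rel (strand a ++ strand b) (strand b ++ strand a)
    (Comp (crs k d2 a b) (Tens (chi (GDot a Da)) (Id (strand b))))
    (Comp (Tens (Id (strand b)) (chi (GDot a Da))) (crsV k d2 b a)).
Hypothesis rel_W4_right : forall (a b : thick) Db, d1 a ->
  rel (strand a ++ strand b) (strand b ++ strand a)
    (Comp (Tens (chi (GDot b Db)) (Id (strand a))) (crs k d2 a b))
    (Comp (crsV k d2 b a) (Tens (Id (strand a)) (chi (GDot b Db)))).

(** The target relation is left abstract: it becomes [dweb_rel] for the translation into
    $\mathbf{Web}^\bullet$, and equality of denotations for the translation back. *)
Lemma emap_web_rel x y f g : web_rel q x y f g -> rel x y (emap f) (emap g).
Proof.
case=> {x y f g} [a b c|a b c|a b c d e|a b|a b|a b|a Da|a Da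
    |a b Da Db|a b Da Db] /=.
- by rewrite !emap_mrg; apply/web_rel_sub/W1_merge.
- by rewrite !emap_spl; apply/web_rel_sub/W1_split.
- by rewrite emap_mrg emap_spl emap_ladders; apply/web_rel_sub/W2.
- by rewrite emap_mrg emap_spl; apply/web_rel_sub/W3.
- by rewrite emap_crs emap_crsV; apply/web_rel_sub/crsVK.
- by rewrite emap_crs emap_crsV; apply/web_rel_sub/crsKV.
- exact: rel_dotVK.
- exact: rel_dotKV.
- by rewrite emap_crs emap_crsV; apply: rel_W4_left.
- by rewrite emap_crs emap_crsV; apply: rel_W4_right.
Qed.
End WebMap.

(** * The two translations and their compositions *)

Section Isomorphism.
Variables (k : fieldType) (q : k).
Hypothesis qint_neq0 : forall n, 0 < n -> (qint q n != 0)%R.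
Local Notation P' := (dweb'_presentation q).
Local Notation P := (dweb_presentation q).

Definition thin_to_all (g : webgen thin_dots) : expr k thick (webgen all_dots) :=
  match g with
  | GMerge a b => Gen (GMerge a b)
  | GSplit a b => Gen (GSplit a b)
  | GCross a b => Gen (GCross a b)
  | GCrossV a b => Gen (GCrossV a b)
  | GDot a _ => dot a isT
  | GDotV a _ => dotV a isT
  end.

Definition all_to_thin (g : webgen all_dots) : expr k thick (webgen thin_dots) :=
  match g with
  | GMerge a b => Gen (GMerge a b)
  | GSplit a b => Gen (GSplit a b)
  | GCross a b => Gen (GCross a b)
  | GCrossV a b => Gen (GCrossV a b)
  | GDot a _ => Scale (qfact q a)^-1%R (explode (dot thin isT) a)
  | GDotV a _ => Scale (qfact q a)^-1%R (explode (dotV thin isT) a)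
  end.

Lemma thin_to_all_typed g : typed (@web_src all_dots) (@web_tgt all_dots)
  (thin_to_all g) (web_src g) (web_tgt g).
Proof.
case: g => [a b|a b|a b|a b|a Da|a Da] /=.
- exact: (typed_gen _ _ _ (GMerge a b)).
- exact: (typed_gen _ _ _ (GSplit a b)).
- exact: (typed_gen _ _ _ (GCross a b)).
- exact: (typed_gen _ _ _ (GCrossV a b)).
- exact: typed_dot.
- exact: typed_dotV.
Qed.

Lemma all_to_thin_typed g : typed (@web_src thin_dots) (@web_tgt thin_dots)
  (all_to_thin g) (web_src g) (web_tgt g).
Proof.
case: g => [a b|a b|a b|a b|a Da|a Da] /=.
- exact: (typed_gen _ _ _ (GMerge a b)).
- exact: (typed_gen _ _ _ (GSplit a b)).
- exact: (typed_gen _ _ _ (GCross a b)).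
- exact: (typed_gen _ _ _ (GCrossV a b)).
- exact/typed_scale/typed_explode/(typed_dot _ _ thin).
- exact/typed_scale/typed_explode/(typed_dotV _ _ thin).
Qed.

Lemma thin_to_all_rel x y f g : web_rel q (dots := thin_dots) x y f g ->
  @eqm k P x y (emap thin_to_all f) (emap thin_to_all g).
Proof.
move=> H; apply: eqm_rel.
apply: (emap_web_rel (rel := @dweb_rel k q) _ _ _ _ _ _ _ _ _ H).
all: try by [].
- by move=> *; apply: dweb_web.
- by move=> a Da; apply/dweb_web/(dotVK q (a := a) isT).
- by move=> a Da; apply/dweb_web/(dotKV q (a := a) isT).
- by move=> a b Da _; apply/dweb_web/(W4_left q (a := a) (b := b) isT isT).
- by move=> a b Db _; apply/dweb_web/(W4_right q (a := a) (b := b) isT isT).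
Qed.

Local Notation D := (thin_dotted qint_neq0).
Local Notation denP' := (@den k P').

Lemma den_all_to_thin_dot a Da : denP' (all_to_thin (GDot a Da)) = ndot D a.
Proof.
by rewrite -[LHS]/(ascale _ (denP' (explode (dot thin isT) a))) den_explode.
Qed.

Lemma den_all_to_thin_dotV a Da : denP' (all_to_thin (GDotV a Da)) = ndotV D a.
Proof.
by rewrite -[LHS]/(ascale _ (denP' (explode (dotV thin isT) a))) den_explode.
Qed.

Local Notation bwd := (emap all_to_thin).

Lemma denComp f g : denP' (Comp f g) = acomp (denP' f) (denP' g).
Proof. by []. Qed.
Lemma denTens f g : denP' (Tens f g) = atens (denP' f) (denP' g).
Proof. by []. Qed.
Lemma denScale a f : denP' (Scale a f) = ascale a (denP' f).
Proof. by []. Qed.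
Lemma bwdComp f g : bwd (Comp f g) = Comp (bwd f) (bwd g).
Proof. by []. Qed.
Lemma bwdTens f g : bwd (Tens f g) = Tens (bwd f) (bwd g).
Proof. by []. Qed.

(** Thick dots go to [ndot] and [ndotV], so (W4) and (W5) become statements of the web calculus; for
    (W6) the factor $[a]!$ cancels against its inverse. *)
Lemma all_to_thin_rel x y f g : dweb_rel q x y f g -> @eqm k P' x y (bwd f) (bwd g).
Proof.
move=> H; have [tf tg] := dweb_rel_typed H.
apply: (@den_eqm k P'); try exact: (typed_emap all_to_thin_typed).
case: H {tf tg} => {x y f g} [x y f g H|a b|a b|a|a].
- apply: (emap_web_rel (rel := fun _ _ f g => denP' f = denP' g)
    _ _ _ _ _ _ _ _ _ H) => //.
  + by move=> x' y' f' g'; apply: den_rel.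
  + move=> a Da; rewrite denComp den_all_to_thin_dot den_all_to_thin_dotV.
    exact: (ndotVK D qint_neq0 a).
  + move=> a Da; rewrite denComp den_all_to_thin_dot den_all_to_thin_dotV.
    exact: (ndotKV D qint_neq0 a).
  + move=> a b Da _; rewrite !denComp !denTens den_all_to_thin_dot.
    exact: (crs_ndotl D qint_neq0 a b).
  + move=> a b Db _; rewrite !denComp !denTens den_all_to_thin_dot.
    exact: (crs_ndotr D qint_neq0 a b).
- rewrite !bwdComp bwdTens !denComp denTens !den_all_to_thin_dot emap_spl //.
  exact: (spl_ndot D qint_neq0 a b).
- rewrite !bwdComp bwdTens !denComp denTens !den_all_to_thin_dot emap_mrg //.
  exact: (mrg_ndot D qint_neq0 a b).
- rewrite emap_explode // den_explode den_all_to_thin_dot denScale.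
  rewrite den_all_to_thin_dot /ndot thick_dot1 ?src_dot ?tgt_dot //.
  by rewrite ascaleA GRing.mulfV ?qfact_neq0 // ascale1.
- rewrite emap_explode // den_explode den_all_to_thin_dotV denScale.
  rewrite den_all_to_thin_dotV /ndotV thick_dot1 ?src_dotV ?tgt_dotV //.
  by rewrite ascaleA GRing.mulfV ?qfact_neq0 // ascale1.
Qed.

Definition web_functor : smfunctor (dweb' q) (dweb q) :=
  presented_functor (@web_rel_typed k q thin_dots)
    thin_to_all_typed thin_to_all_rel.

Definition web_functor_inv : smfunctor (dweb q) (dweb' q) :=
  presented_functor (@dweb_rel_typed k q)
    all_to_thin_typed all_to_thin_rel.

(** A dot generator here has thickness 1, and $x_1$ is recovered from its own formula because
    $[1]!=1$. *)
Lemma thin_to_allK g : @eqm k P' (web_src g) (web_tgt g)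
  (bwd (thin_to_all g)) (Gen g).
Proof.
apply: (@den_eqm k P').
- exact: (typed_emap all_to_thin_typed (thin_to_all_typed g)).
- exact: (typed_gen _ _ _ g).
case: g => // a Da; have ea : a = thin by apply/val_inj/eqP.
  subst a; rewrite -[bwd _]/(all_to_thin (GDot thin isT)) den_all_to_thin_dot.
  rewrite /ndot thick_dot1 ?src_dot ?tgt_dot //.
  by congr (denP' (Gen (GDot _ _))); apply: bool_irrelevance.
subst a; rewrite -[bwd _]/(all_to_thin (GDotV thin isT)) den_all_to_thin_dotV.
rewrite /ndotV thick_dot1 ?src_dotV ?tgt_dotV //.
by congr (denP' (Gen (GDotV _ _))); apply: bool_irrelevance.
Qed.

(** On dots this is (W6) divided by $[a]!$. *)
Lemma all_to_thinK g : @eqm k P (web_src g) (web_tgt g)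
  (emap thin_to_all (all_to_thin g)) (Gen g).
Proof.
have scaleK a (f e : expr k thick (webgen all_dots)) :
    @eqm k P (strand a) (strand a) e (Scale (qfact q a) f) ->
  @eqm k P (strand a) (strand a) (Scale (qfact q a)^-1%R e) f.
  (* Inverting the typing of the scaled expression yields the typing of [f] that the scaling rules
     require. *)
  move=> H; have [_ Hs] := eqm_typed H; inversion Hs; subst.
  apply: eqm_trans (eqm_scale _ H) _; apply: eqm_trans (eqm_scaleA _ _ _) _ => //.
  by rewrite GRing.mulVf ?qfact_neq0 //; apply: eqm_scale1.
have Dirr a (Da : all_dots a) : Da = isT by apply: bool_irrelevance.
case: g => [a b|a b|a b|a b|a Da|a Da].
- by apply: eqm_refl; apply: (typed_gen _ _ _ (GMerge a b)).
- by apply: eqm_refl; apply: (typed_gen _ _ _ (GSplit a b)).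
- by apply: eqm_refl; apply: (typed_gen _ _ _ (GCross a b)).
- by apply: eqm_refl; apply: (typed_gen _ _ _ (GCrossV a b)).
- rewrite (Dirr a Da); apply: (@scaleK a (dot a isT)
    (emap thin_to_all (explode (dot thin isT) a))).
  by rewrite emap_explode //; apply/eqm_rel/W6_dot.
- rewrite (Dirr a Da); apply: (@scaleK a (dotV a isT)
    (emap thin_to_all (explode (dotV thin isT) a))).
  by rewrite emap_explode //; apply/eqm_rel/W6_dotV.
Qed.

Lemma web_functorE x y f
    (Hf : typed (@web_src thin_dots) (@web_tgt thin_dots) f x y) :
  fmor web_functor (mor (P := P') Hf) =
  mor (P := P) (typed_emap thin_to_all_typed Hf).
Proof. exact: (presented_morE _ thin_to_all_typed thin_to_all_rel Hf). Qed.

Lemma web_functor_invE x y f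
    (Hf : typed (@web_src all_dots) (@web_tgt all_dots) f x y) :
  fmor web_functor_inv (mor (P := P) Hf) =
  mor (P := P') (typed_emap all_to_thin_typed Hf).
Proof. exact: (presented_morE _ all_to_thin_typed all_to_thin_rel Hf). Qed.

Lemma web_functorK : inverse_functors web_functor web_functor_inv.
Proof.
split=> // x y; elim/mor_ind=> f Hf.
  rewrite web_functorE web_functor_invE; congr (arr _).
  by apply/mor_eqP/(emapK (P := P')) => //; apply: thin_to_allK.
rewrite web_functor_invE web_functorE; congr (arr _).
by apply/mor_eqP/(emapK (P := P)) => //; apply: all_to_thinK.
Qed.

Lemma web_functor_mor x y f g
    (Hf : typed (@web_src thin_dots) (@web_tgt thin_dots) f x y)
    (Hg : typed (@web_src all_dots) (@web_tgt all_dots) g x y) :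
  @eqm k P x y (emap thin_to_all f) g ->
  arr (fmor web_functor (mor (P := P') Hf)) =
  arr (H := @hom k (dweb q)) (mor (P := P) Hg).
Proof. by move=> e; rewrite web_functorE; congr (arr _); apply/mor_eqP. Qed.
End Isomorphism.

(** * Quantum integers over $\mathbb C(q)$ *)

Section Cq.
Local Open Scope ring_scope.
Import GRing.Theory.
Variable R : realType.
Local Notation q := (Cq_q R).

Lemma Cq_q_neq0 : q != 0.
Proof. by rewrite tofrac_eq0 polyX_eq0. Qed.

Lemma Cq_q_unity n : (0 < n)%N -> q ^+ n != 1.
Proof.
move=> n_gt0; rewrite -tofracXn -tofrac1 tofrac_eq.
apply: contraTneq (n_gt0) => /(congr1 (size : {poly R[i]} -> nat)).
by rewrite size_polyXn size_poly1 => -[->].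
Qed.

(** An equality $q^m=q^{-m}$ would give $q^{2m}=1$, whereas the indeterminate has infinite order.
    The case $m=1$ takes care of the denominator. *)
Lemma Cq_qint_neq0 n : (0 < n)%N -> qint q n != 0.
Proof.
have sub_neq0 m : (0 < m)%N -> q ^+ m - q ^- m != 0.
  move=> m_gt0; rewrite subr_eq0.
  apply: contra (Cq_q_unity (n := m + m) _) => [/eqP e|].
    by rewrite exprD {2}e divff // expf_neq0 // Cq_q_neq0.
  by rewrite addn_gt0 m_gt0.
move=> n_gt0; rewrite mulf_neq0 ?sub_neq0 // invr_neq0 //.
by have := sub_neq0 1%N isT; rewrite expr1.
Qed.
End Cq.

Theorem theorem2p13 (R : realType) :
  let q := Cq_q R in
  exists F : smfunctor (dweb' q) (dweb q),
    sm_isomorphism F /\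
    (forall a : thick, F [:: a] = [:: a]) /\
    (forall a b : thick,
       arr (fmor F (dweb'_merge q a b)) = arr (dweb_merge q a b)) /\
    (forall a b : thick,
       arr (fmor F (dweb'_split q a b)) = arr (dweb_split q a b)) /\
    (forall a b : thick,
       arr (fmor F (dweb'_cross q a b)) = arr (dweb_cross q a b)) /\
    arr (fmor F (dweb'_dot1 q)) = arr (dweb_dot q thin) /\
    (forall a : thick, 2 <= a ->
       arr (fmor F (dweb'_dot q a)) = arr (dweb_dot q a)) /\
    (forall a : thick,
       arr (fmor F (dweb'_dotV q a)) = arr (dweb_dotV q a)).
Proof.
move=> q; have qn0 := @Cq_qint_neq0 R.
exists (web_functor q); split.
  by exists (web_functor_inv qn0); apply: web_functorK.
split=> //; split=> [a b|].
  apply: web_functor_mor; rewrite emap_mrg //; exact/eqm_refl/typed_mrg.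
split=> [a b|].
  apply: web_functor_mor; rewrite emap_spl //; exact/eqm_refl/typed_spl.
split=> [a b|].
  apply: web_functor_mor; rewrite emap_crs //; exact/eqm_refl/typed_crs.
split.
  apply: web_functor_mor; exact/eqm_refl/(typed_dot _ _ thin).
split=> [a _|a].
  (* The scaled class unfolds to the class of [all_to_thin (GDot a isT)], so its image is computed
     by the round trip [all_to_thinK]. *)
  rewrite /dweb'_dot phom_scaleE pscaleE.
  apply: web_functor_mor; apply: (all_to_thinK qn0 (GDot a isT)).
rewrite /dweb'_dotV phom_scaleE pscaleE.
apply: web_functor_mor; apply: (all_to_thinK qn0 (GDotV a isT)).
Qed.
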